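(* For every real $\alpha\ge 1$, $$\dim_H E(\alpha)=\inf_{q>0}\{t(q)+q\alpha\},$$ where $E(\alpha)=\{x\in(0,1]:\lim_{n\to\infty}\frac1n S_n(x)=\alpha\}$ is the level set of the Birkhoff averages of the Saint-Petersburg potential under the doubling map, and, for $q>0$, $t(q)$ is the unique real number with $\sum_{j=1}^{\infty}2^{-t(q)j-q(2^j-1)}=1$. Consequently, $\dim_H E(1)=0$, and the function $\alpha\mapsto\dim_H E(\alpha)$ on $[1,\infty)$ is strictly increasing, concave, real-analytic on $(1,\infty)$, and has limit $1$ as $\alpha\to\infty$.
   Context: $T:(0,1]\to(0,1]$ is the doubling map $Tx=2x-\lceil 2x\rceil+1$, where $\lceil y\rceil$ is the smallest integer $\ge y$. The Saint-Petersburg potential $\varphi:(0,1]\to\mathbb{R}$ is defined by $\varphi(x)=2^n$ if $x\in(2^{-n-1},2^{-n}]$, for each integer $n\ge0$. For $n\ge1$, $S_n(x)=\varphi(x)+\varphi(Tx)+\cdots+\varphi(T^{n-1}x)$. For $t\in\mathbb{R}$ and $q>0$ let $P(t,q)=\log\sum_{j=1}^{\infty}2^{-tj-q(2^j-1)}$; for each $q>0$ there is a unique real number $t(q)$ with $P(t(q),q)=0$. $\dim_H$ denotes Hausdorff dimension. *)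

(* Defs.v *)
From mathcomp Require Import all_boot all_order all_algebra.
From mathcomp Require Import all_classical all_reals all_analysis.
From mathcomp Require Import zify ring lra.

Set Implicit Arguments.
Unset Strict Implicit.
Unset Printing Implicit Defensive.

Import Order.TTheory GRing.Theory Num.Theory.
Import numFieldNormedType.Exports.

Local Open Scope classical_set_scope.
Local Open Scope ring_scope.

Section HausdorffDimension.
Context {R : realType}.
Implicit Types (s delta : R) (A : set R).

(* The point 0 is adjoined to the set of distances so that diam set0 = 0. *)
Definition diam A : \bar R :=
  ereal_sup (0%E |` [set `|x.1 - x.2|%:E | x in A `*` A]).

(* Empty sets have weight 0 for every s, including s = 0: by convention
   0 `^ 0 = 1, so a singleton has weight 1 for s = 0. *)
Definition hausdorff_weight s A : \bar R :=
  if A == set0 then 0%E else poweR (diam A) s.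

Definition delta_cover delta A : set (nat -> set R) :=
  [set U | A `<=` \bigcup_i U i /\ forall i, (diam (U i) <= delta%:E)%E].

Definition hausdorff_premeasure s delta A : \bar R :=
  ereal_inf [set (\sum_(0 <= i <oo) hausdorff_weight s (U i))%E
            | U in delta_cover delta A].

(* The premeasure is nonincreasing in delta, so this supremum is its limit
   as delta tends to 0. *)
Definition hausdorff_measure s A : \bar R :=
  ereal_sup [set hausdorff_premeasure s delta A | delta in [set d | 0 < d]].

Definition hausdorff_dim A : \bar R :=
  ereal_inf [set s%:E | s in [set s | 0 <= s /\ hausdorff_measure s A = 0%E]].

End HausdorffDimension.

Section RealFunctions.
Context {R : realType}.
Implicit Types (D : set R) (f : R -> R).

Definition concave_on D f := forall x y l, D x -> D y -> 0 <= l <= 1 ->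
  l * f x + (1 - l) * f y <= f (l * x + (1 - l) * y).

Definition real_analytic_on D f := forall a, D a ->
  exists (c : nat -> R) (r : R), 0 < r /\
    forall x, `|x - a| < r -> pseries c (x - a) n @[n --> \oo] --> f x.

End RealFunctions.

Section SaintPetersburg.
Context {R : realType}.
Implicit Types (x alpha t q : R) (n : nat).

(* T and the potential live on (0, 1]; here they are total functions
   on R whose values outside (0, 1] are never used, since T maps
   (0, 1] to itself (doubling_map_itv). *)
Definition doubling_map x : R := 2 * x - (Num.ceil (2 * x))%:~R + 1.

Definition saint_petersburg x : R :=
  xget 0 [set y | exists n, (2 ^- n.+1 < x <= 2 ^- n) /\ y = 2 ^+ n].

Definition birkhoff_sum n x : R :=
  \sum_(i < n) saint_petersburg (iter i doubling_map x).

Definition level_set alpha : set R :=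
  [set x | 0 < x <= 1 /\ n%:R^-1 * birkhoff_sum n x @[n --> \oo] --> alpha].

Definition pressure_sum t q : \bar R :=
  (\sum_(1 <= j <oo) (2 `^ (- (t * j%:R) - q * (2 ^+ j - 1)))%:E)%E.

(* For q > 0 this is the unique t with pressure_sum t q = 1: see pressure_rootP and
   pressure_sum_unique. *)
Definition pressure_root q : R := xget 0 [set t | pressure_sum t q = 1%E].

Lemma doubling_map_itv x : 0 < doubling_map x <= 1.
Proof.
rewrite /doubling_map; have := real_ceil_itv (num_real (2 * x)).
rewrite intrB => /andP[]; lra.
Qed.

Lemma saint_petersburgE n x : 2 ^- n.+1 < x <= 2 ^- n ->
  saint_petersburg x = 2 ^+ n.
Proof.
have lt_inv (a b : nat) : (2 : R) ^- a < 2 ^- b -> (b < a)%N.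
  by rewrite ltf_pV2 ?posrE ?exprn_gt0// ltr_eXn2l// ltr1n.
move=> /andP[nx xn]; rewrite /saint_petersburg.
case: xgetP => [y -> [m [/andP[mx xm] ->]]|/(_ (2 ^+ n))]; last first.
  by case; exists n; rewrite nx xn.
have := lt_inv _ _ (lt_le_trans nx xm); have := lt_inv _ _ (lt_le_trans mx xn).
by rewrite !ltnS => nm mn; congr (_ ^+ _); apply/eqP; rewrite eqn_leq nm mn.
Qed.

Definition pressure_term t q j : R := 2 `^ (- (t * j%:R) - q * (2 ^+ j - 1)).

(* Such coefficients define an everywhere convergent power series. *)
Definition rapid (c : nat -> R) :=
  forall K : R, 0 < K -> exists M, forall j, `|c j| * K ^+ j <= M.

Lemma rapid_diffs c : rapid c -> rapid (pseries_diffs c).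
Proof.
move=> rc K K0; have [|M hM] := rc (2 * K); first by rewrite mulr_gt0.
exists (M / K) => j; rewrite ler_pdivlMr// /pseries_diffs normrM normr_nat.
apply: le_trans (hM j.+1); rewrite exprMn -mulrA -exprSr -mulrA mulrCA.
rewrite ler_wpM2l// ler_wpM2r ?exprn_ge0 ?ltW//.
by rewrite -natrX ltr_nat ltn_expl.
Qed.

Lemma rapid_cvg c K : rapid c -> 0 < K -> cvgn (pseries c K).
Proof.
move=> rc K0; have [|M hM] := rc (2 * K); first by rewrite mulr_gt0.
apply: normed_cvg; apply: (@series_le_cvg _ _ (geometric M 2^-1)) => /=.
- by [].
- by move=> n; rewrite mulr_ge0 ?exprn_ge0// (le_trans _ (hM 0%N))// mulr_ge0.
- move=> n; rewrite normrM (ger0_norm (exprn_ge0 _ (ltW K0))).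
  by rewrite exprVn ler_pdivlMr ?exprn_gt0// -mulrA -exprMn (mulrC K).
- apply/cvg_ex; eexists; apply: cvg_geometric_series.
  by rewrite ger0_norm// invf_lt1// ltr1n.
Qed.

Definition pressure_coef q j : R := if j is 0%N then 0 else (2 `^ (- q)) ^+ (2 ^ j - 1).

Lemma pressure_coef_ge0 q j : 0 <= pressure_coef q j.
Proof. by case: j => [//|j]; rewrite exprn_ge0 ?powR_ge0. Qed.

Lemma leq_exp2 j : (j * j.-1 <= 2 * (2 ^ j - 1))%N.
Proof.
elim: j => // j IH; have j2 : (j < 2 ^ j)%N by rewrite ltn_expl.
have -> : (j.+1 * j.+1.-1 = j * j.-1 + 2 * j)%N by case: (j) => //= i; ring.
by move: IH j2; rewrite expnS; move: (2 ^ j)%N (j * j.-1)%N => a b; lia.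
Qed.

Lemma pressure_coef_rapid q : 0 < q -> rapid (pressure_coef q).
Proof.
move=> q0 K K0; pose r : R := 2 `^ (- q).
have r0 : 0 < r by rewrite powR_gt0.
have r1 : r < 1.
  rewrite /r powRN invf_lt1 ?powR_gt0// /powR pnatr_eq0/= expR_gt1.
  by rewrite mulr_gt0// ln_gt0// ltr1n.
have [m mK] : exists m, r ^+ m * K <= 1.
  have : geometric K r @ \oo --> 0 by apply: cvg_geometric; rewrite ger0_norm// ltW.
  move=> /cvgrPdist_le/(_ 1 ltr01)[m _ /(_ m (leqnn m))] /=.
  by rewrite sub0r normrN => /(le_trans (ler_norm _)); exists m; rewrite mulrC.
have K1 : 1 <= 1 + K by rewrite lerDl ltW.
have M1 k : 1 <= (1 + K) ^+ k by rewrite exprn_ege1.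
exists ((1 + K) ^+ (2 * m).+1) => j.
rewrite ger0_norm ?pressure_coef_ge0//; case: j => [|j].
  by rewrite mul0r (le_trans ler01).
rewrite /pressure_coef -/r; have [jm|mj] := leqP j.+1 (2 * m).+1.
  have {}r1 := ltW r1; have {}r0 := ltW r0; have {}K0 := ltW K0.
  rewrite -[leRHS]mul1r ler_pM ?exprn_ge0 ?exprn_ile1//.
  apply: (@le_trans _ _ ((1 + K) ^+ j.+1)); last by rewrite ler_weXn2l.
  by rewrite lerXn2r ?nnegrE ?addr_ge0// lerDr ler01.
have {}r1 := ltW r1; have {}r0 := ltW r0; have {}K0 := ltW K0.
apply: le_trans (M1 _); apply: (@le_trans _ _ ((r ^+ m * K) ^+ j.+1)).
  rewrite exprMn -exprM ler_wpM2r ?exprn_ge0// ler_wiXn2l//.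
  by move: (leq_exp2 j.+1) mj => /=; move: (2 ^ j.+1)%N => a; nia.
by rewrite exprn_ile1// mulr_ge0 ?exprn_ge0.
Qed.

Lemma pressure_termE t q j : (0 < j)%N -> pressure_term t q j = pressure_coef q j * (2 `^ (- t)) ^+ j.
Proof.
case: j => // j _; rewrite /pressure_term /pressure_coef powRD; last by rewrite pnatr_eq0 implybT.
rewrite mulrC -[- (q * _)]mulNr -[- (t * _)]mulNr !powRrM -!powR_mulrn ?powR_ge0//.
by rewrite powR_mulrn ?ler0n// natrB ?expn_gt0// natrX.
Qed.

Lemma pressure_sumE t q : 0 < q ->
  pressure_sum t q = (limn (pseries (pressure_coef q) (2 `^ (- t))))%:E.
Proof.
move=> q0; rewrite -EFin_lim; last first.
  by apply: rapid_cvg; [exact: pressure_coef_rapid|rewrite powR_gt0].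
congr (limn _); apply/funext => -[|n].
  by rewrite big_geq//= /pseries /series /= big_geq.
rewrite sumEFin /= /pseries /series /= [in RHS]big_ltn// mul0r add0r.
by congr EFin; apply: eq_big_nat => j /andP[j0 _]; rewrite -pressure_termE.
Qed.

Lemma pressure_sum_lt t t' q : t < t' -> pressure_sum t q = 1%E ->
  pressure_sum t' q != 1%E.
Proof.
move=> tt' h; rewrite lt_eqF//.
apply: (@le_lt_trans _ _ ((2 `^ (t - t'))%:E * pressure_sum t q)%E).
  have tm0 u v i : (0 <= (2 `^ (- (u * i%:R) - v * (2 ^+ i - 1)))%:E :> \bar R)%E.
    by rewrite lee_fin powR_ge0.
  rewrite /pressure_sum -!(@nneseries_addn _ _ 1)// -nneseriesZl//.
  apply: lee_nneseries => // j _; rewrite lee_fin addn1 -powRD; last first.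
    by rewrite pnatr_eq0 implybT.
  rewrite ler_powR ?ler1n// addrA lerD2r.
  have : (t' - t) * 1 <= (t' - t) * j.+1%:R by rewrite ler_wpM2l ?ler1n ?subr_ge0 ?(ltW tt').
  lra.
rewrite h mule1 lte_fin /powR pnatr_eq0/= expR_lt1.
by rewrite pmulr_llt0 ?ln_gt0 ?ltr1n// subr_lt0.
Qed.

Lemma pressure_sum_unique q : 0 < q -> exists! t, pressure_sum t q = 1%E.
Proof.
move=> q0; pose G x := limn (pseries (pressure_coef q) x).
have rq := pressure_coef_rapid q0.
have cG : {within `[0, 2 `^ q], continuous G}.
  apply: derivable_within_continuous => x _.
  have K0 : 0 < `|x| + 1 by rewrite ltr_wpDl.
  have [] // := @pseries_snd_diffs _ (pressure_coef q) (`|x| + 1) x.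
  - exact: rapid_cvg.
  - exact/rapid_cvg/K0/rapid_diffs.
  - exact/rapid_cvg/K0/rapid_diffs/rapid_diffs.
  - by rewrite (gtr0_norm K0) ltrDl.
have G0 : G 0 = 0.
  apply/cvg_lim => //; apply: cvg_near_cst; apply: nearW => n.
  rewrite /pseries /series /= big1// => -[|j] _; first by rewrite mul0r.
  by rewrite expr0n mulr0.
have Gq : 1 <= G (2 `^ q).
  have := pressure_sumE (- q) q0; rewrite opprK -/(G _) => GE.
  rewrite -lee_fin -GE; have := @nneseries_lim_ge R
    (fun j => (2 `^ (- (- q * j%:R) - q * (2 ^+ j - 1)))%:E) xpredT 1 2.
  rewrite big_nat1 (_ : _ - _ = 0) ?powRr0; last by rewrite expr1; ring.
  by apply=> n _ _; rewrite lee_fin powR_ge0.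
have /(IVT (powR_ge0 2 q) cG)[x] :
    Num.min (G 0) (G (2 `^ q)) <= 1 <= Num.max (G 0) (G (2 `^ q)).
  by rewrite G0 ge_min le_max ler01 Gq orbT.
rewrite in_itv/= => /andP[x0 _] Gx.
have {}x0 : 0 < x.
  rewrite lt_neqAle x0 andbT; apply: contra_eq_neq Gx => <-.
  by rewrite G0 eq_sym oner_eq0.
have n2 : ln 2 != 0 :> R by rewrite gt_eqF// ln_gt0// ltr1n.
pose t := - (ln x / ln 2); have ht : pressure_sum t q = 1%E.
  rewrite pressure_sumE// opprK; congr EFin; rewrite -[RHS]Gx /G.
  by congr (limn (pseries _ _)); rewrite /powR pnatr_eq0/= divfK// lnK// posrE.
exists t; split=> // t' ht'; case: (ltgtP t t') => // tt'.
- by move/eqP: (pressure_sum_lt tt' ht).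
- by move/eqP: (pressure_sum_lt tt' ht').
Qed.

Lemma pressure_rootP q : 0 < q -> pressure_sum (pressure_root q) q = 1%E.
Proof.
move=> /pressure_sum_unique[t [ht _]]; rewrite /pressure_root.
by case: xgetP => [u -> //|/(_ t)].
Qed.

End SaintPetersburg.

(* Main.v *)
(** A point of (0, 1] is a sequence of binary blocks 0^(j-1) 1; a block of length
    j contributes 2^j - 1 to the Birkhoff sum, so the level set prescribes the
    limit of the ratio weight / length. Covering it by the cylinders of long words
    with ratio below alpha + epsilon, the masses 2^(-t length - q weight) with
    t > t(q) sum to a convergent geometric series, which bounds the dimension by
    t(q) + q alpha. For alpha > 1 the infimum d(alpha) is attained at a q where the
    mean of weight - alpha length vanishes. A Chernoff estimate near that q gives,
    for c < d(alpha), a set of 2^(c l) words of common length l and common weight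
    at most alpha l; concatenating them freely, and inserting one heavy block
    whenever the weight falls behind, produces an image of [0, 1) in the level set
    under a map whose inverse is Hoelder of exponent close to c. Finally d is a
    Legendre transform, hence concave, and solving the two critical equations by a
    contraction in a Banach algebra of power series shows that it is analytic. *)
Require Import Defs.
From mathcomp Require Import all_boot all_order all_algebra.
From mathcomp Require Import all_classical all_reals all_analysis.
From mathcomp Require Import zify ring lra.

Set Implicit Arguments.
Unset Strict Implicit.
Unset Printing Implicit Defensive.

Import Order.TTheory GRing.Theory Num.Theory.
Import numFieldNormedType.Exports.

Local Open Scope classical_set_scope.
Local Open Scope ring_scope.

(** At t = t(q) the block masses add up to 1, so each q > 0 gives a probability on an infinite
    alphabet. As q tends to 0 it approaches the fair coin, for which the mean weight is infinite; as
    q tends to infinity it concentrates on the block of length 1, of ratio 1. Hence every ratio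
    above 1 is the mean ratio of some q, while 1 is only a limit: for alpha = 1 the infimum is not
    attained, and the matching lower bound is the trivial one. The unbounded potential does no harm
    in the pressure, because the factor in q decays doubly exponentially along the blocks and beats
    every function of geometric growth. In the lower bound only finitely many words are used, and
    positivity of the potential controls the Birkhoff sums between word ends. A class of words of
    common weight is found with ratio at most alpha, but not with ratio exactly alpha; this is why a
    heavy block is inserted. Its length, which brings no choices, is paid from the margin between
    the exponent c of the family and a slightly smaller exponent s. Analyticity is an implicit
    function theorem; a norm on power series lets one fixed point argument produce the solution and
    its expansion together. *)

Section Series.
Context {R : realType}.
Implicit Types (a b : nat -> R) (s u k : R).

Lemma le_of_eq (x y : R) : x = y -> x <= y.
Proof. by move=> ->. Qed.

(** Convergence and value in one relation: identities between infinite sums then follow termwise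
    from [sums_unique]. *)
Variant sums a s : Prop := Sums of series a n @[n --> \oo] --> s.

Lemma lim_sums a s : sums a s -> limn (series a) = s.
Proof. by case=> h; exact: cvg_lim h. Qed.

Lemma sums_lim a : cvgn (series a) -> sums a (limn (series a)).
Proof. by split. Qed.

Lemma sums_unique a s u : sums a s -> sums a u -> s = u.
Proof. by move=> /lim_sums <- /lim_sums. Qed.

Lemma eq_sums a b s : a =1 b -> sums a s -> sums b s.
Proof. by move=> /funext ->. Qed.

Lemma sumsD a b s u : sums a s -> sums b u -> sums (fun n => a n + b n) (s + u).
Proof.
move=> [h1] [h2]; split; rewrite (_ : series _ = series a + series b); last first.
  by apply/funext => n; rewrite /series /= fctE big_split.
exact: cvgD.
Qed.

Lemma sumsZ k a s : sums a s -> sums (fun n => k * a n) (k * s).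
Proof.
move=> [h]; split; rewrite (_ : series _ = fun n => k * series a n); last first.
  by apply/funext => n; rewrite /series /= mulr_sumr.
by apply: cvgMl_tmp.
Qed.

Lemma sumsN a s : sums a s -> sums (fun n => - a n) (- s).
Proof.
by move=> /(sumsZ (-1)); rewrite mulN1r; apply: eq_sums => n; rewrite mulN1r.
Qed.

Lemma sumsB a b s u : sums a s -> sums b u -> sums (fun n => a n - b n) (s - u).
Proof. by move=> h1 /sumsN h2; exact: sumsD. Qed.

Lemma sums_ge a s n : (forall i, 0 <= a i) -> sums a s -> series a n <= s.
Proof.
move=> a0 [h]; rewrite -(cvg_lim (@Rhausdorff R) h).
by apply: nondecreasing_cvgn_le; [exact: nondecreasing_series|exact: cvgP h].
Qed.

Lemma sums_le_bound a s u : (forall n, series a n <= u) -> sums a s -> s <= u.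
Proof.
move=> au [h]; rewrite -(cvg_lim (@Rhausdorff R) h); apply: limr_le; first exact: cvgP h.
exact: nearW.
Qed.

Lemma sums_le a b s u : (forall n, a n <= b n) -> sums a s -> sums b u -> s <= u.
Proof.
move=> ab [ha] [hb]; rewrite -(cvg_lim (@Rhausdorff R) ha) -(cvg_lim (@Rhausdorff R) hb).
by apply: lim_series_le => //; [exact: cvgP ha|exact: cvgP hb].
Qed.

(** Weierstrass test, with the bound on the sum kept for later estimates. *)
Lemma sums_dom a b u : (forall n, `|a n| <= b n) -> sums b u ->
  exists2 s, sums a s & `|s| <= u.
Proof.
move=> ab [hb].
have cn : cvgn [series `|a n|]_n.
  apply: (series_le_cvg _ _ ab (cvgP _ hb)) => n //.
  exact: le_trans (ab n).
exists (limn (series a)); first by apply: sums_lim; exact: normed_cvg cn.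
apply: le_trans (lim_series_norm cn) _.
rewrite -(cvg_lim (@Rhausdorff R) hb).
by apply: lim_series_le => //; exact: cvgP hb.
Qed.

Lemma sums_bounded a u : (forall n, 0 <= a n) -> (forall n, series a n <= u) ->
  exists2 s, sums a s & s <= u.
Proof.
move=> a0 au.
have h : cvgn (series a).
  apply: nondecreasing_is_cvgn; first exact: nondecreasing_series.
  by exists u => _ [n _ <-].
by exists (limn (series a)); [exact: sums_lim|exact: (sums_le_bound au (sums_lim h))].
Qed.

Lemma sums_geo r : 0 <= r < 1 -> sums (fun n => r ^+ n) (1 - r)^-1.
Proof.
move=> /andP[r0 r1]; split; have := @cvg_geometric_series R 1 r.
rewrite ger0_norm// => /(_ r1); rewrite mul1r; apply: cvg_trans.
by rewrite (_ : geometric 1 r = fun n => r ^+ n)//; apply/funext => n; rewrite /= mul1r.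
Qed.

Lemma sums_half : sums (fun n => 2^-1 ^+ n.+1) 1.
Proof.
have h : 0 <= (2^-1 : R) < 1 by rewrite invr_ge0 ler0n/= invf_lt1// ltr1n.
have := sumsZ 2^-1 (sums_geo h); rewrite (_ : _ * _ = 1); last by field.
by apply: eq_sums => n; rewrite exprS.
Qed.

End Series.

(** * Pressure and its root *)

Section Moments.
Context {R : realType}.
Implicit Types (t q K : R) (g h : nat -> R) (n : nat).

(* Blocks are indexed from 0: the index n stands for j = n + 1. *)
Definition len n : R := n.+1%:R.
Definition wt n : R := 2 ^+ n.+1 - 1.
Definition bterm t q n : R := pressure_term t q n.+1.

Lemma ln2_gt0 : 0 < ln 2 :> R.
Proof. by rewrite ln_gt0// ltr1n. Qed.

Lemma pow2E t : 2 `^ t = expR (t * ln 2) :> R.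
Proof. by rewrite /powR pnatr_eq0. Qed.

Lemma btermE t q n : bterm t q n = expR (- (t * len n + q * wt n) * ln 2).
Proof. by rewrite /bterm /pressure_term pow2E opprD. Qed.

Lemma bterm_gt0 t q n : 0 < bterm t q n.
Proof. by rewrite btermE expR_gt0. Qed.

Lemma bterm_ge0 t q n : 0 <= bterm t q n.
Proof. exact/ltW/bterm_gt0. Qed.

Lemma bterm_shift t q t' q' n :
  bterm t' q' n = bterm t q n * expR (- ((t' - t) * len n + (q' - q) * wt n) * ln 2).
Proof. by rewrite !btermE -expRD; congr expR; ring. Qed.

Lemma len_ge1 n : 1 <= len n.
Proof. by rewrite /len ler1n. Qed.

Lemma len_le_wt n : len n <= wt n.
Proof.
rewrite /len /wt; elim: n => [|n IH]; first by rewrite expr1; lra.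
have h : 1 <= (2:R) ^+ n.+1 by rewrite exprn_ege1// ler1n.
by move: IH h; rewrite (exprS _ n.+1) [n.+2%:R]mulrS; lra.
Qed.

Lemma len_gt0 n : 0 < len n. Proof. exact: lt_le_trans (len_ge1 n). Qed.
Lemma wt_ge1 n : 1 <= wt n. Proof. exact: le_trans (len_ge1 n) (len_le_wt n). Qed.
Lemma wt_gt0 n : 0 < wt n. Proof. exact: lt_le_trans (wt_ge1 n). Qed.

Lemma bterm_le t q t' q' n : t <= t' -> q <= q' -> bterm t' q' n <= bterm t q n.
Proof.
move=> tt' qq'; rewrite !btermE ler_expR ler_wpM2r ?(ltW ln2_gt0)// lerN2.
by rewrite lerD// ler_wpM2r// ltW// ?len_gt0 ?wt_gt0.
Qed.

(** The class of coefficients for which all moments below converge: it contains [len] and [wt], is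
    closed under products, and is beaten by the doubly exponential decay of [bterm t q] as soon as q
    > 0, whatever t is. *)
Definition expgrowth g := exists C K, [/\ 0 <= C, 0 < K & forall n, `|g n| <= C * K ^+ n].

Lemma expgrowth_cst k : expgrowth (fun=> k).
Proof. by exists `|k|, 1; split => // n; rewrite expr1n mulr1. Qed.

Lemma expgrowth_wt : expgrowth wt.
Proof.
exists 2, 2; split => // n; rewrite ger0_norm ?(ltW (wt_gt0 n))//.
by rewrite /wt -exprS gerBl.
Qed.

Lemma expgrowth_le g h : (forall n, `|g n| <= `|h n|) -> expgrowth h -> expgrowth g.
Proof. by move=> gh [C [K [C0 K0 H]]]; exists C, K; split => // n; exact: le_trans (gh n) (H n). Qed.

Lemma expgrowth_len : expgrowth len.
Proof.
apply: expgrowth_le expgrowth_wt => n; rewrite !gtr0_norm ?len_gt0 ?wt_gt0//; exact: len_le_wt.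
Qed.

Lemma expgrowth_mul g h : expgrowth g -> expgrowth h -> expgrowth (fun n => g n * h n).
Proof.
move=> [C [K [C0 K0 H]]] [C' [K' [C'0 K'0 H']]]; exists (C * C'), (K * K').
split; rewrite ?mulr_ge0 ?mulr_gt0// => n.
by rewrite normrM exprMn mulrACA ler_pM.
Qed.

Lemma expgrowth_add g h : expgrowth g -> expgrowth h -> expgrowth (fun n => g n + h n).
Proof.
move=> [C [K [C0 K0 H]]] [C' [K' [C'0 K'0 H']]]; exists (C + C'), (K + K').
split; rewrite ?addr_ge0 ?addr_gt0// => n.
apply: le_trans (ler_normD _ _) _; rewrite mulrDl lerD//.
- apply: le_trans (H n) _; rewrite ler_wpM2l// lerXn2r ?nnegrE ?addr_ge0 ?(ltW K0) ?(ltW K'0)//.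
  by rewrite lerDl ltW.
- apply: le_trans (H' n) _; rewrite ler_wpM2l// lerXn2r ?nnegrE ?addr_ge0 ?(ltW K0) ?(ltW K'0)//.
  by rewrite lerDr ltW.
Qed.

Lemma expgrowth_abs g : expgrowth g -> expgrowth (fun n => `|g n|).
Proof. by apply: expgrowth_le => n; rewrite normr_id. Qed.

Lemma bterm_rapid t q K : 0 < q -> 0 < K ->
  exists2 C, 0 <= C & forall n, K ^+ n * bterm t q n <= C * 2^-1 ^+ n.+1.
Proof.
move=> q0 K0; pose x : R := 2 `^ (- t); have x0 : 0 < x by rewrite powR_gt0.
(* The extra factor 2 in the rate leaves the summable factor 2^(-n-1). *)
have [|M hM] := pressure_coef_rapid q0 (_ : 0 < 2 * K * x); first by rewrite !mulr_gt0.
have M0 : 0 <= M by apply: le_trans (hM 0%N); rewrite mulr_ge0.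
exists (M / K); first by rewrite divr_ge0// ltW.
move=> n; have := hM n.+1; rewrite ger0_norm ?pressure_coef_ge0//.
move: (pressure_termE t q (ltn0Sn n)); rewrite -/(bterm t q n) -/x => ->.
rewrite exprVn !ler_pdivlMr ?exprn_gt0//; apply: le_trans.
by apply: le_of_eq; rewrite !exprMn [K ^+ n.+1]exprS; ring.
Qed.

Lemma expgrowth_abs_sums g t q : 0 < q -> expgrowth g ->
  exists s, sums (fun n => `|g n| * bterm t q n) s.
Proof.
move=> q0 [C [K [C0 K0 H]]]; have [C' C'0 H'] := bterm_rapid t q0 K0.
have [|s hs _] := @sums_dom _ (fun n => `|g n| * bterm t q n) _ _ _ (sumsZ (C * C') (@sums_half R)).
  move=> n; rewrite ger0_norm ?mulr_ge0 ?bterm_ge0//.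
  rewrite -mulrA; apply: (@le_trans _ _ (C * (K ^+ n * bterm t q n))).
    by rewrite mulrA ler_wpM2r ?bterm_ge0.
  by rewrite ler_wpM2l.
by exists s.
Qed.

Definition moment g t q : R := limn (series (fun n => g n * bterm t q n)).

Lemma moment_sums g t q : 0 < q -> expgrowth g ->
  sums (fun n => g n * bterm t q n) (moment g t q).
Proof.
move=> q0 /(expgrowth_abs_sums t q0)[s hs].
have [|u hu _] := @sums_dom _ (fun n => g n * bterm t q n) _ _ _ hs.
  by move=> n; rewrite normrM (ger0_norm (bterm_ge0 t q n)).
by rewrite /moment (lim_sums hu).
Qed.

Lemma moment_le g h t q : 0 < q -> expgrowth g -> expgrowth h ->
  (forall n, g n <= h n) -> moment g t q <= moment h t q.
Proof.
move=> q0 eg eh gh; apply: (sums_le _ (moment_sums t q0 eg) (moment_sums t q0 eh)).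
by move=> n; rewrite ler_wpM2r ?bterm_ge0.
Qed.

Lemma expR_lip (x y B : R) : expR x <= B -> expR y <= B -> `|expR x - expR y| <= `|x - y| * B.
Proof.
have key (u v : R) : expR u - expR v <= (u - v) * expR u.
  have := expR_ge1Dx (v - u); rewrite expRD expRN ler_pdivlMr ?expR_gt0//; lra.
move=> xB yB; have B0 := le_trans (expR_ge0 x) xB.
have hb (u v : R) : expR u <= B -> expR u - expR v <= `|u - v| * B.
  move=> uB; apply: (le_trans (key u v)); apply: (le_trans (ler_norm _)).
  by rewrite normrM (ger0_norm (expR_ge0 u)) ler_wpM2l.
by rewrite ler_norml lerNl opprB hb// distrC hb.
Qed.

(** On this quadrant every [bterm] is at most its value at the corner (t0, q0), so the moment of |g|
    wt at the corner, times ln 2, is a uniform Lipschitz constant; [len_le_wt] absorbs the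
    derivative in t. *)
Lemma moment_lip g t0 q0 : 0 < q0 -> expgrowth g ->
  exists2 C, 0 <= C & forall t t' q q', t0 <= t -> t0 <= t' -> q0 <= q -> q0 <= q' ->
    `|moment g t q - moment g t' q'| <= C * (`|t - t'| + `|q - q'|).
Proof.
move=> q00 eg; have egw : expgrowth (fun n => `|g n| * wt n) by apply: expgrowth_mul; [exact: expgrowth_abs|exact: expgrowth_wt].
have hs := moment_sums t0 q00 egw; set s := moment _ _ _ in hs.
have s0 : 0 <= s.
  apply: le_trans (sums_ge 0 _ hs); first by rewrite /series /= big_geq.
  by move=> n; rewrite !mulr_ge0 ?bterm_ge0// ltW ?wt_gt0.
have l0 := ltW ln2_gt0.
exists (ln 2 * s); first by rewrite mulr_ge0.
move=> t t' q q' tt tt' qq qq'.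
have h1 := moment_sums t (lt_le_trans q00 qq) eg.
have h2 := moment_sums t' (lt_le_trans q00 qq') eg.
have [|u hu us] := @sums_dom _ (fun n => g n * bterm t q n - g n * bterm t' q' n) _ _ _ (sumsZ (ln 2 * (`|t - t'| + `|q - q'|)) hs).
  move=> n; rewrite -mulrBr normrM.
  have := @expR_lip (- (t * len n + q * wt n) * ln 2) (- (t' * len n + q' * wt n) * ln 2) (bterm t0 q0 n).
  rewrite -!btermE => /(_ (bterm_le _ tt qq) (bterm_le _ tt' qq')) h.
  rewrite [leRHS](_ : _ = `|g n| * ((`|t - t'| + `|q - q'|) * wt n * ln 2 * bterm t0 q0 n)); last by ring.
  rewrite ler_wpM2l//; apply: le_trans h _; rewrite ler_wpM2r ?bterm_ge0//.
  rewrite -mulrBl normrM (ger0_norm l0) ler_wpM2r//.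
  rewrite (_ : _ - _ = (t' - t) * len n + (q' - q) * wt n); last by ring.
  apply: le_trans (ler_normD _ _) _; rewrite !normrM mulrDl lerD//.
    by rewrite distrC ler_wpM2l// (ger0_norm (ltW (len_gt0 n))) len_le_wt.
  by rewrite distrC ler_wpM2l// ger0_norm// ltW// wt_gt0.
rewrite -(sums_unique hu (sumsB h1 h2)).
by apply: le_trans us _; apply: le_of_eq; ring.
Qed.

End Moments.

(** * Monotonicity and convexity of the pressure and of its root *)

Section Pressure.
Context {R : realType}.
Implicit Types (a t q u : R) (n : nat).

Local Notation len := (@len R).
Local Notation wt := (@wt R).

(** The exponential of P(t, q): the equation P(t, q) = 0 becomes [pressure t q = 1]. *)
Definition pressure t q : R := moment (fun=> 1) t q.
(** Up to the factor -ln 2, the derivative of [pressure] in the direction (-a, 1), which keeps t + q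
    a constant. *)
Definition drift a t q : R := moment (fun n => wt n - a * len n) t q.

Lemma pressure_sums t q : 0 < q -> sums (bterm t q) (pressure t q).
Proof.
move=> q0; move: (moment_sums t q0 (expgrowth_cst (1:R))).
by apply: eq_sums => n; rewrite mul1r.
Qed.

Lemma expgrowth_drift a : expgrowth (fun n => wt n - a * len n).
Proof.
apply: expgrowth_add; first exact: expgrowth_wt.
apply: (@expgrowth_le _ _ (fun n => a * len n)); first by move=> n; rewrite normrN.
by apply: expgrowth_mul; [exact: expgrowth_cst|exact: expgrowth_len].
Qed.

Lemma drift_sums a t q : 0 < q ->
  sums (fun n => (wt n - a * len n) * bterm t q n) (drift a t q).
Proof. by move=> q0; exact: moment_sums (expgrowth_drift a). Qed.

Lemma driftE a t q : 0 < q -> drift a t q = moment wt t q - a * moment len t q.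
Proof.
move=> q0; apply: (sums_unique (drift_sums a t q0)).
have := sumsB (moment_sums t q0 expgrowth_wt) (sumsZ a (moment_sums t q0 expgrowth_len)).
by apply: eq_sums => n; ring.
Qed.

Lemma pressure_sum_pressure t q : 0 < q -> pressure_sum t q = (pressure t q)%:E.
Proof.
move=> q0; rewrite /pressure_sum -(@nneseries_addn _ _ 1); last first.
  by move=> i; rewrite lee_fin powR_ge0.
have hs := pressure_sums t q0; have [h] := hs; rewrite -(lim_sums hs) -EFin_lim; last exact: cvgP h.
congr (limn _); apply/funext => n /=; rewrite /series /= -sumEFin.
by apply: eq_bigr => i _; rewrite addn1.
Qed.

Lemma pressure_ge_series t q n : 0 < q -> series (bterm t q) n <= pressure t q.
Proof. by move=> q0; apply: sums_ge (pressure_sums t q0) => i; exact: bterm_ge0. Qed.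

Lemma pressure_gt0 t q : 0 < q -> 0 < pressure t q.
Proof.
move=> q0; apply: lt_le_trans (pressure_ge_series t 1 q0).
by rewrite /series /= big_nat1 bterm_gt0.
Qed.

Lemma pressure_decr t t' q : 0 < q -> t <= t' ->
  pressure t' q <= 2 `^ (t - t') * pressure t q.
Proof.
move=> q0 tt'; apply: (sums_le _ (pressure_sums t' q0) (sumsZ _ (pressure_sums t q0))) => n.
rewrite (bterm_shift t q) mulrC ler_wpM2r ?bterm_ge0// pow2E ler_expR ler_wpM2r ?(ltW ln2_gt0)//.
rewrite subrr mul0r addr0.
have : (t' - t) * 1 <= (t' - t) * len n by rewrite ler_wpM2l ?subr_ge0 ?len_ge1.
lra.
Qed.

Lemma pow2_lt1 u : u < 0 -> 2 `^ u < 1 :> R.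
Proof. by move=> u0; rewrite pow2E expR_lt1 pmulr_llt0 ?ln2_gt0. Qed.

Local Notation root := (@pressure_root R).

Lemma pressure_root1 q : 0 < q -> pressure (root q) q = 1.
Proof. by move=> q0; have := pressure_rootP q0; rewrite pressure_sum_pressure// => -[]. Qed.

Lemma pressure_lt1 t q : 0 < q -> (pressure t q < 1) = (root q < t).
Proof.
move=> q0; apply/idP/idP => [h|h].
- rewrite ltNge; apply/negP => tr; have := pressure_decr q0 tr.
  rewrite pressure_root1// => h1; have : 2 `^ (t - root q) <= 1 :> R.
    by rewrite pow2E expR_le1 mulr_le0_ge0 ?(ltW ln2_gt0)// subr_le0.
  move=> h2; have := pressure_gt0 t q0; move: h h1 h2.
  set x := pressure _ _; set y := _ `^ _ => *; nra.
- apply: le_lt_trans (pressure_decr q0 (ltW h)) _.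
  by rewrite pressure_root1// mulr1 pow2_lt1// subr_lt0.
Qed.

Lemma pressure_le1 t q : 0 < q -> root q <= t -> pressure t q <= 1.
Proof.
move=> q0; rewrite le_eqVlt => /orP[/eqP <-|]; first by rewrite pressure_root1.
by rewrite -pressure_lt1// => /ltW.
Qed.

(** At t = -q the block of length 1 alone has mass 1, so the pressure exceeds 1. This bound is what
    makes [root q + q * a] positive for a >= 1. *)
Lemma root_gtN q : 0 < q -> - q < root q.
Proof.
move=> q0; rewrite ltNge -[_ <= _]negbK -ltNge; apply/negP; rewrite -leNgt => h.
have := pressure_le1 q0 h; apply/negP; rewrite -ltNge.
apply: lt_le_trans (pressure_ge_series _ 2 q0).
rewrite /series /= big_nat_recr//= big_nat1 [X in X + _](_ : _ = 1) ?ltrDl ?bterm_gt0//.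
by rewrite btermE /len /wt expr1 -(expR0 R); congr expR; ring.
Qed.

Lemma bterm1 q n : bterm 1 q n = 2^-1 ^+ n.+1 * 2 `^ (- (q * wt n)).
Proof.
rewrite btermE pow2E exprVn -powR_mulrn// -powRN pow2E -expRD; congr expR.
by rewrite /len; ring.
Qed.

(** At t = 1 the masses are those of the fair coin, damped by at least 2^(-q). *)
Lemma root_lt1 q : 0 < q -> root q < 1.
Proof.
move=> q0; rewrite -pressure_lt1//.
apply: (@le_lt_trans _ _ (2 `^ (- q) * 1)); last by rewrite mulr1 pow2_lt1// oppr_lt0.
apply: (sums_le _ (pressure_sums 1 q0) (sumsZ _ sums_half)) => n.
rewrite bterm1 mulrC ler_wpM2r ?exprn_ge0// ler_powR ?ler1n// lerN2.
by rewrite ler_peMr ?(ltW q0) ?wt_ge1.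
Qed.

Lemma root_nincr q q' : 0 < q -> q <= q' -> root q' <= root q.
Proof.
move=> q0 qq'; have q'0 := lt_le_trans q0 qq'.
rewrite leNgt; apply/negP => h; have : ~~ (pressure (root q) q' < 1).
  by rewrite pressure_lt1// -leNgt ltW.
have := pressure_decr q'0 (ltW h); rewrite pressure_root1//.
have : pressure (root q) q' <= 1.
  rewrite -(pressure_root1 q0).
  by apply: (sums_le _ (pressure_sums _ q'0) (pressure_sums _ q0)) => n; exact: bterm_le.
have : 2 `^ (root q - root q') < 1 :> R by rewrite pow2_lt1// subr_lt0.
have := powR_ge0 2 (root q - root q') : 0 <= _ :> R.
move: (2 `^ _) (pressure _ _) => x y; nra.
Qed.

Lemma moment_len_ge1 t q : 0 < q -> pressure t q = 1 -> 1 <= moment len t q.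
Proof.
move=> q0 h; rewrite -h; apply: moment_le => //; [exact: expgrowth_cst|exact: expgrowth_len|exact: len_ge1].
Qed.

(* The tangent line of the convex function exp at 0, summed over the blocks. *)
Lemma tangent t q t' q' : 0 < q -> 0 < q' -> pressure t q = 1 -> pressure t' q' <= 1 ->
  0 <= (t' - t) * moment len t q + (q' - q) * moment wt t q.
Proof.
move=> q0 q'0 h h'.
have h1 := sumsB (pressure_sums t q0) (sumsZ (ln 2) (sumsD (sumsZ (t' - t) (moment_sums t q0 expgrowth_len))
   (sumsZ (q' - q) (moment_sums t q0 expgrowth_wt)))).
have : pressure t q - ln 2 * ((t' - t) * moment len t q + (q' - q) * moment wt t q) <= 1.
  apply: le_trans h'; apply: (sums_le _ h1 (pressure_sums t' q'0)) => n.
  rewrite (bterm_shift t q t' q').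
  have := expR_ge1Dx (- ((t' - t) * len n + (q' - q) * wt n) * ln 2).
  move=> /(ler_wpM2l (bterm_ge0 t q n)); apply: le_trans.
  by apply: le_of_eq; ring.
by rewrite h gerBl pmulr_rge0 ?ln2_gt0.
Qed.

(** Convexity of [root q + q * a] in q, with subgradient minus drift over mean length: a zero of the
    drift is a minimum, and elsewhere its sign tells on which side the function increases. *)
Lemma tangent_drift a q q' : 0 < q -> 0 < q' ->
  0 <= ((root q' + q' * a) - (root q + q * a)) * moment len (root q) q
       + (q' - q) * drift a (root q) q.
Proof.
move=> q0 q'0; have := @tangent (root q) q (root q') q' q0 q'0 (pressure_root1 q0).
rewrite pressure_root1// => /(_ (lexx _)); rewrite driftE//.
by move/le_trans; apply; apply: le_of_eq; ring.
Qed.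

(** The points (root q, q) with q in [qa, qb] stay in the quadrant with corner (-qb, qa), where
    [moment_lip] applies; the root itself is Lipschitz by [tangent], as the mean length is at least
    1. *)
Lemma root_moment_lip g qa qb : 0 < qa -> expgrowth g -> exists2 C, 0 <= C &
  forall q q', qa <= q <= qb -> qa <= q' <= qb ->
    `|moment g (root q) q - moment g (root q') q'| <= C * `|q - q'|.
Proof.
move=> qa0 eg; have [C C0 H] := moment_lip (- qb) qa0 eg.
pose M := moment wt (- qb) qa.
have rlip q q' : qa <= q -> q <= q' -> q' <= qb -> `|root q - root q'| <= M * `|q - q'|.
  move=> h1 h2 h3; have q0 := lt_le_trans qa0 h1; have q'0 := lt_le_trans q0 h2.
  rewrite ger0_norm ?subr_ge0 ?root_nincr// distrC ger0_norm ?subr_ge0//.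
  have rq : - qb <= root q.
    by apply: le_trans (ltW (root_gtN q0)); rewrite lerN2 (le_trans h2).
  have := @tangent (root q) q (root q') q' q0 q'0 (pressure_root1 q0).
  rewrite pressure_root1// => /(_ (lexx _)).
  have : moment wt (root q) q <= M.
    apply: (sums_le _ (moment_sums _ q0 expgrowth_wt) (moment_sums _ qa0 expgrowth_wt)) => n.
    by rewrite ler_wpM2l ?(ltW (wt_gt0 n))// bterm_le.
  have := moment_len_ge1 q0 (pressure_root1 q0).
  have := root_nincr q0 h2.
  move: (root q') => w.
  have : 0 <= q' - q by rewrite subr_ge0.
  move: (root q) (moment wt (root q) q) (moment len _ _) => z y x; nra.
have rlip2 q q' : qa <= q <= qb -> qa <= q' <= qb -> `|root q - root q'| <= M * `|q - q'|.
  move=> /andP[h1 h2] /andP[h3 h4]; have [h|h] := leP q q'; first exact: rlip.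
  by rewrite distrC (distrC q); apply: rlip => //; exact: ltW.
have M0 : 0 <= M.
  apply: le_trans (sums_ge 0 _ (moment_sums _ qa0 expgrowth_wt)); first by rewrite /series /= big_geq.
  by move=> n; rewrite mulr_ge0 ?bterm_ge0// ltW ?wt_gt0.
exists (C * (M + 1)); first by rewrite mulr_ge0// addr_ge0.
move=> q q' hq hq'; have := rlip2 _ _ hq hq'.
move: hq hq' => /andP[h1 h2] /andP[h3 h4] h5.
have rb x : qa <= x -> x <= qb -> - qb <= root x.
  move=> hx hx'; apply: le_trans (ltW (root_gtN (lt_le_trans qa0 hx))).
  by rewrite lerN2.
apply: le_trans (H _ _ _ _ (rb _ h1 h2) (rb _ h3 h4) h1 h3) _.
by rewrite -mulrA ler_wpM2l// mulrDl mul1r lerD2r.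
Qed.

End Pressure.

(** * The critical parameter, at which the drift vanishes *)

Section Critical.
Context {R : realType}.
Implicit Types (a t q u : R) (n : nat).

Local Notation len := (@len R).
Local Notation wt := (@wt R).
Local Notation root := (@pressure_root R).

Lemma wt_len_ge n : (0 < n)%N -> n%:R <= wt n - len n :> R.
Proof.
case: n => // n _; rewrite /wt /len; elim: n => [|n IH]; first by rewrite !mulrS mulr0n expr2; lra.
have h : 2 * 1 <= (2:R) ^+ n.+2 by rewrite exprS ler_wpM2l// exprn_ege1// ler1n.
move: IH h; rewrite (exprS _ n.+2) (mulrS _ n.+2) (mulrS _ n.+1) (mulrS _ n).
by move: (2 ^+ n.+2) n%:R => x y; lra.
Qed.

(** For large q only the block of length 1 counts: relative to it every longer block loses a factor
    2^(-u), because its weight exceeds its length by at least 1, and what remains is one fixed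
    summable sequence. *)
Lemma bterm_tail t u n : 0 <= u -> - (1 + u) <= t -> (0 < n)%N ->
  bterm t (1 + u) n <= bterm t (1 + u) 0 * (2 `^ (- u) * bterm (-1) 1 n).
Proof.
move=> u0 ht n0; rewrite !btermE pow2E -!expRD ler_expR -!mulrDl ler_wpM2r ?(ltW ln2_gt0)//.
have h1 := wt_len_ge n0; have h2 : 1 <= n%:R :> R by rewrite ler1n.
have -> : len 0 = 1 by [].
have -> : wt 0 = 1 by rewrite /wt expr1; lra.
have h3 := len_ge1 n : 1 <= len n; move: (len n) (wt n) (n%:R) h1 h2 h3 => x y z; nra.
Qed.

Lemma series_delta0 n : series (fun n => (n == 0%N)%:R : R) n = (0 < n)%:R.
Proof.
rewrite /series /=; case: n => [|n]; first by rewrite big_geq.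
rewrite big_nat_recl//= big1 ?addr0// => i _.
Qed.

Lemma sums_delta0 : sums (fun n => (n == 0%N)%:R : R) 1.
Proof.
split; apply: (@cvg_near_cst _ _ (1:R)); exists 1%N => // n /= n0.
by rewrite series_delta0 n0.
Qed.

Lemma exists_pow2_lt (e : R) : 0 < e -> exists2 u, 0 <= u & 2 `^ (- u) < e.
Proof.
move=> e0; exists (`|ln e / ln 2| + 1); first by rewrite addr_ge0.
rewrite pow2E -ltr_ln ?posrE ?expR_gt0// expRK.
rewrite -ltr_pdivlMr ?ln2_gt0//.
have := ler_norm (- (ln e / ln 2)); rewrite normrN; lra.
Qed.

(** By [bterm_tail] the mass 2^(-(root q + q)) of the first block is close to 1 for large q; the
    tangent bound 1 + x ln 2 <= 2^x turns this into smallness of the exponent. *)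
Lemma root_plus_small (e : R) : 0 < e -> exists2 q, 0 < q & root q + q < e.
Proof.
move=> e0; pose C := pressure (-1) 1 : R.
have C0 : 0 < C by exact: pressure_gt0.
have d0 : 0 < e * ln 2 / C by rewrite divr_gt0// mulr_gt0// ln2_gt0.
have [u u0 hu] := exists_pow2_lt d0.
have q0 : 0 < 1 + u by rewrite ltr_wpDr.
exists (1 + u) => //; set q := 1 + u in q0 *.
have p0 : bterm (root q) q 0 = 2 `^ (- (root q + q)).
  by rewrite btermE pow2E /len /wt expr1; congr expR; ring.
have h : pressure (root q) q <= bterm (root q) q 0 * (1 + 2 `^ (- u) * C).
  apply: (sums_le _ (pressure_sums _ q0) (sumsZ _ (sumsD sums_delta0 (sumsZ _ (pressure_sums (-1) ltr01))))).
  case=> [|n] /=.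
    by rewrite ler_peMr ?bterm_ge0// lerDl mulr_ge0 ?powR_ge0 ?bterm_ge0.
  by rewrite add0r; apply: bterm_tail => //; exact/ltW/root_gtN.
move: h; rewrite pressure_root1// p0 powRN ler_pdivlMl ?powR_gt0// mulr1 => h.
have : 2 `^ (root q + q) < 1 + e * ln 2.
  apply: le_lt_trans h _; rewrite ltrD2l -ltr_pdivlMr//.
have := expR_ge1Dx ((root q + q) * ln 2); rewrite -pow2E => h1 h2.
by have := le_lt_trans h1 h2; rewrite ltrD2l ltr_pM2r ?ln2_gt0.
Qed.

(** For large q the first block, contributing 1 - a times its mass, outweighs all others by
    [bterm_tail]. *)
Lemma drift_neg a : 1 < a -> exists2 q, 1 <= q & drift a (root q) q < 0.
Proof.
move=> a1; pose C := moment wt (-1) 1 : R.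
have hC := moment_sums (-1) ltr01 (@expgrowth_wt R).
have t0 n : 0 <= wt n * bterm (-1) 1 n by rewrite mulr_ge0 ?bterm_ge0// ltW ?wt_gt0.
have C0 : 0 < C.
  apply: lt_le_trans (sums_ge 1 t0 hC).
  by rewrite /series /= big_nat1 mulr_gt0 ?wt_gt0 ?bterm_gt0.
have d0 : 0 < (a - 1) / C by rewrite divr_gt0// subr_gt0.
have [u u0 hu] := exists_pow2_lt d0.
have q0 : 0 < 1 + u by rewrite ltr_wpDr.
exists (1 + u); first by rewrite lerDl.
set q := 1 + u in q0 *.
apply: (@le_lt_trans _ _ (bterm (root q) q 0 * ((1 - a) * 1 + 2 `^ (- u) * C))).
  apply: (sums_le _ (drift_sums a _ q0) (sumsZ _ (sumsD (sumsZ (1 - a) sums_delta0) (sumsZ _ hC)))).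
  case=> [|n] /=.
    have -> : wt 0 = 1 by rewrite /wt expr1; ring.
    have -> : len 0 = 1 by [].
    by rewrite mulrC ler_wpM2l ?bterm_ge0// !mulr1 lerDl mulr_ge0 ?powR_ge0// mul1r bterm_ge0.
  rewrite mulr0 add0r.
  apply: (@le_trans _ _ (wt n.+1 * bterm (root q) q n.+1)).
    rewrite ler_wpM2r ?bterm_ge0// gerBl mulr_ge0 ?(ltW (len_gt0 _))//; lra.
  rewrite [leRHS](_ : _ = wt n.+1 * (bterm (root q) q 0 * (2 `^ (- u) * bterm (-1) 1 n.+1))); last by ring.
  rewrite ler_wpM2l ?(ltW (wt_gt0 _))//.
  by apply: bterm_tail => //; exact/ltW/root_gtN.
rewrite pmulr_rlt0 ?bterm_gt0// mulr1.
have : 2 `^ (- u) * C < a - 1 by rewrite -ltr_pdivlMr.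
lra.
Qed.

Lemma series_half n : series (fun n => 2^-1 ^+ n.+1) n = 1 - 2^-1 ^+ n :> R.
Proof.
elim: n => [|n IH]; first by rewrite /series /= big_geq// expr0 subrr.
by rewrite seriesSr IH !exprS; field.
Qed.

(** With t = 1 - 2 d, a block gains a factor at least 2^(2 d) over the fair coin, and q is so small
    that its damping costs at most 2^(-d) on the first J blocks. Their total mass is then at least
    2^d (1 - 2^(-J)) > 1. *)
Lemma root_near1 t : t < 1 -> exists2 q, 0 < q & t < root q.
Proof.
move=> t1; pose d := (1 - t) / 2; have d0 : 0 < d by rewrite divr_gt0// subr_gt0.
have h1 : 0 < 1 - 2 `^ (- d) :> R by rewrite subr_gt0 pow2_lt1// oppr_lt0.
have [J hJ] : exists J, 2^-1 ^+ J < 1 - 2 `^ (- d) :> R.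
  have := @cvg_geometric R 1 2^-1.
  rewrite ger0_norm ?invr_ge0// invf_lt1// ltr1n => /(_ isT)/cvgrPdist_lt/(_ _ h1)[J _ /(_ J (leqnn J))].
  rewrite /= sub0r normrN mul1r => hJ; exists J; exact: le_lt_trans (ler_norm _) hJ.
pose q := d / 2 ^+ J; have q0 : 0 < q by rewrite divr_gt0// exprn_gt0.
exists q => //; rewrite ltNge; apply/negP => h.
have := pressure_le1 q0 h; apply/negP; rewrite -ltNge.
apply: (lt_le_trans _ (pressure_ge_series t J q0)).
apply: (@lt_le_trans _ _ (2 `^ d * (1 - 2^-1 ^+ J))).
  apply: (@le_lt_trans _ _ (2 `^ d * 2 `^ (- d))); first by rewrite powRN mulfV ?gt_eqF ?powR_gt0.
  by rewrite ltr_pM2l ?powR_gt0//; lra.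
rewrite -series_half /series /= mulr_sumr ler_sum_nat// => n /andP[_ nJ].
rewrite exprVn -powR_mulrn// -powRN !pow2E -expRD btermE ler_expR -mulrDl ler_wpM2r ?(ltW ln2_gt0)//.
have : q * wt n <= d.
  rewrite /q -mulrA ler_piMr ?(ltW d0)// mulrC ler_pdivrMr ?exprn_gt0// mul1r.
  by rewrite /wt lerBlDr ler_wpDr// ler_weXn2l ?ler1n.
have := len_ge1 n : 1 <= len n; rewrite -/(len n) /d.
move: (len n) (q * wt n) => x y; nra.
Qed.

Lemma series_len_half n : series (fun i => len i * 2^-1 ^+ i.+1) n <= 2.
Proof.
suff -> : series (fun i => len i * 2^-1 ^+ i.+1) n = 2 - (n%:R + 2) * 2^-1 ^+ n.
  by rewrite gerBl mulr_ge0 ?addr_ge0 ?exprn_ge0.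
elim: n => [|n IH]; first by rewrite /series /= big_geq// expr0; ring.
by rewrite seriesSr IH /len exprS -natr1; field.
Qed.

(** Under the fair coin the block n contributes 1 - 2^(-n-1) to the mean weight, which is therefore
    infinite, while the mean length is 2. For small q the masses of the first J blocks are within a
    factor 2 of the fair ones: their weights sum to about J/2 or more, their lengths to at most
    4. *)
Lemma drift_pos a : 1 <= a -> exists2 q, 0 < q <= 1 & 0 < drift a (root q) q.
Proof.
move=> a1; pose J := (Num.truncn (8 * a)).+2.
(* The weight part (J - 1)/2 thus exceeds the length part 4 a; moreover all terms from J on are
   nonnegative. *)
have hJ : 8 * a < J%:R - 1.
  rewrite /J [(_ (8 * a)).+2%:R]mulrSr addrK.
  have a8 : 0 <= 8 * a by rewrite mulr_ge0// (le_trans _ a1).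
  by have /andP[] := truncn_itv a8.
have J0 : 0 < J%:R :> R by rewrite ltr0n.
have jl1 : 1 - J%:R^-1 < 1 :> R by rewrite gtrBl invr_gt0.
have [q1 q10 hq1] := root_near1 jl1.
pose q := Num.min q1 (2^-1 ^+ J).
have q0 : 0 < q by rewrite lt_min q10 exprn_gt0.
have qq1 : q <= q1 by rewrite ge_min lexx.
have qJ : q <= 2^-1 ^+ J by rewrite ge_min lexx orbT.
exists q; first by rewrite q0/= (le_trans qJ)// exprn_ile1// invf_le1// ler1n.
have rq : 1 - J%:R^-1 < root q by apply: lt_le_trans hq1 _; exact: root_nincr.
have r1 := root_lt1 q0.
have tpos n : (J <= n)%N -> 0 <= (wt n - a * len n) * bterm (root q) q n.
  move=> Jn; rewrite mulr_ge0 ?bterm_ge0// subr_ge0.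
  have := @leq_exp2 n.+1; rewrite /= -(ler_nat R) !natrM natrB ?expn_gt0// natrX.
  rewrite -/(wt n) -/(len n) => h.
  have : 2 * a * len n <= n%:R * len n.
    rewrite ler_wpM2r ?(ltW (len_gt0 n))//.
    have : J%:R <= n%:R :> R by rewrite ler_nat.
    by move: hJ; move: J%:R => x; nra.
  by move: h; rewrite [len n * _]mulrC -mulrA; lra.
apply: (@lt_le_trans _ _ (series (fun n => (wt n - a * len n) * bterm (root q) q n) J)); last first.
  rewrite -[leRHS](lim_sums (drift_sums a (root q) q0)).
  have [/cvgP h] := drift_sums a (root q) q0.
  apply: limr_ge => //; exists J => // n /= Jn.
  rewrite /series /= [leRHS](@big_cat_nat _ _ _ J)//= lerDl big_nat_cond sumr_ge0// => i /andP[/andP[Ji _] _].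
  exact: tpos.
apply: (@lt_le_trans _ _ (series (fun n => 2^-1 * (1 - 2^-1 ^+ n.+1) - 2 * a * (len n * 2^-1 ^+ n.+1)) J)).
  have -> : series (fun n => 2^-1 * (1 - 2^-1 ^+ n.+1) - 2 * a * (len n * 2^-1 ^+ n.+1)) J =
     2^-1 * (J%:R - (1 - 2^-1 ^+ J)) - 2 * a * series (fun i => len i * 2^-1 ^+ i.+1) J.
    rewrite -series_half /series /= sumrB -!mulr_sumr sumrB sumr_const_nat subn0.
    by rewrite -mulr_natr mul1r.
  have h1 : 0 <= 2^-1 ^+ J :> R by rewrite exprn_ge0.
  have h2 : 2 * a * series (fun i => len i * 2^-1 ^+ i.+1) J <= 2 * a * 2.
    by rewrite ler_wpM2l ?series_len_half// mulr_ge0// (le_trans _ a1).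
  lra.
rewrite /series /= ler_sum_nat// => n /andP[_ nJ].
have wtE : 2^-1 ^+ n.+1 * wt n = 1 - 2^-1 ^+ n.+1.
  by rewrite /wt mulrBr mulr1 -exprMn mulVf// expr1n.
have hw : q * wt n <= 1.
  apply: (@le_trans _ _ (2^-1 ^+ J * 2 ^+ J)); last by rewrite -exprMn mulVf// expr1n.
  rewrite ler_pM ?(ltW q0) ?(ltW (wt_gt0 n))//.
  by rewrite /wt lerBlDr ler_wpDr// ler_weXn2l ?ler1n.
have hb : 2^-1 ^+ n.+1 * 2^-1 <= bterm (root q) q n.
  apply: le_trans (bterm_le n (ltW r1) (lexx q)).
  rewrite bterm1 ler_wpM2l ?exprn_ge0// -[leLHS]powR_inv1// ler_powR ?ler1n//.
  by rewrite lerN2.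
have hb2 : bterm (root q) q n <= 2 * 2^-1 ^+ n.+1.
  rewrite btermE exprVn -powR_mulrn// -powRN pow2E -{2}[2]powRr1// pow2E -expRD ler_expR.
  rewrite -mulrDl ler_wpM2r ?(ltW ln2_gt0)// -/(len n).
  have : (1 - root q) * len n <= J%:R^-1 * J%:R.
    by rewrite ler_pM ?(ltW (len_gt0 n)) ?subr_ge0 ?(ltW r1)//; [lra|rewrite ler_nat].
  rewrite mulVf ?gt_eqF//.
  have := wt_gt0 n : 0 < wt n; move: (len n) (wt n) q0 => x y; nra.
rewrite mulrBl lerD//.
  apply: le_trans (ler_wpM2l (ltW (wt_gt0 n)) hb).
  by rewrite -wtE; apply: le_of_eq; ring.
rewrite lerN2 -mulrA mulrCA -mulrA ler_wpM2l ?(le_trans _ a1)//.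
by rewrite mulrCA ler_wpM2l// ltW// len_gt0.
Qed.

Lemma critical_point a : 1 < a -> exists2 q, 0 < q & drift a (root q) q = 0.
Proof.
move=> a1; have [qa /andP[qa0 qa1] ha] := drift_pos (ltW a1); have [qb qb1 hb] := drift_neg a1.
have qab : qa <= qb := le_trans qa1 qb1.
have [C C0 HC] := root_moment_lip qb qa0 (expgrowth_drift a).
pose f q := drift a (root q) q.
have cf : {within `[qa, qb], continuous f}.
  apply/subspace_continuousP => x xab; apply/cvgrPdist_le => e e0.
  have d0 : 0 < e / (C + 1) by rewrite divr_gt0// ltr_wpDl.
  have hd : \forall y \near x, `|x - y| <= e / (C + 1).
    by have /cvgrPdist_le := @cvg_id _ (nbhs (x : R)); exact.
  rewrite near_withinE; apply: filterS hd => y hy yab.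
  have xab' : qa <= x <= qb by move: xab; rewrite /= in_itv.
  have yab' : qa <= y <= qb by move: yab; rewrite /= in_itv.
  apply: le_trans (HC _ _ xab' yab') _.
  apply: (@le_trans _ _ ((C + 1) * `|x - y|)); first by rewrite ler_wpM2r// lerDl.
  by rewrite mulrC -ler_pdivlMr ?ltr_wpDl.
have /(IVT qab cf)[x] : Num.min (f qa) (f qb) <= 0 <= Num.max (f qa) (f qb).
  by rewrite ge_min le_max (ltW ha) (ltW hb) orbT.
by rewrite in_itv/= => /andP[x0 _] fx; exists x => //; exact: lt_le_trans x0.
Qed.
End Critical.

(** * The Legendre transform of the pressure root *)

Section DimensionFunction.
Context {R : realType}.
Implicit Types (a b q t : R).

Local Notation root := (@pressure_root R).

Definition legendre a : R := inf [set root q + q * a | q in [set q | 0 < q]].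

Lemma root_affine_gt0 a q : 1 <= a -> 0 < q -> 0 < root q + q * a.
Proof.
move=> a1 q0; have := root_gtN q0; have : q * 1 <= q * a by rewrite ler_wpM2l// ltW.
by lra.
Qed.

Lemma legendre_ge a c : (forall q, 0 < q -> c <= root q + q * a) -> c <= legendre a.
Proof.
move=> h; apply: lb_le_inf; first by exists (root 1 + 1 * a); exists 1 => //=.
by move=> _ [q /= q0 <-]; exact: h.
Qed.

Lemma legendre_le a q : 1 <= a -> 0 < q -> legendre a <= root q + q * a.
Proof.
move=> a1 q0; apply: ge_inf; last by exists q.
by exists 0 => _ [p /= p0 <-]; exact/ltW/root_affine_gt0.
Qed.

Lemma legendre_ge0 a : 1 <= a -> 0 <= legendre a.
Proof. by move=> a1; apply: legendre_ge => q q0; exact/ltW/root_affine_gt0. Qed.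

Lemma ereal_inf_legendre a : 1 <= a ->
  ereal_inf [set (root q + q * a)%:E | q in [set q | 0 < q]] = (legendre a)%:E.
Proof.
move=> a1; rewrite /legendre -ereal_inf_EFin.
- by rewrite image_comp.
- by exists 0 => _ [p /= p0 <-]; exact/ltW/root_affine_gt0.
- by exists (root 1 + 1 * a); exists 1 => //=.
Qed.

Lemma legendre_critical a q : 1 <= a -> 0 < q -> drift a (root q) q = 0 ->
  legendre a = root q + q * a.
Proof.
move=> a1 q0 h; apply/eqP; rewrite eq_le legendre_le//=.
apply: legendre_ge => q' q'0; have := tangent_drift a q0 q'0.
rewrite h mulr0 addr0 pmulr_lge0 ?subr_ge0//.
exact: lt_le_trans (moment_len_ge1 q0 (pressure_root1 q0)).
Qed.

Lemma legendre1 : legendre 1 = 0.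
Proof.
apply/eqP; rewrite eq_le legendre_ge0// andbT.
apply/ler_addgt0Pl => e e0; rewrite addr0.
have [q q0 hq] := root_plus_small e0.
by apply: le_trans (legendre_le _ q0) _ => //; rewrite mulr1 ltW.
Qed.

(** Strictness comes from the minimum at b being attained at some q > 0: the affine function of this
    q has positive slope and bounds the transform at a from above. *)
Lemma legendre_lt a b : 1 <= a -> a < b -> legendre a < legendre b.
Proof.
move=> a1 ab; have b1 := le_lt_trans a1 ab.
have [q q0 hq] := critical_point b1; rewrite (legendre_critical (ltW b1) q0 hq).
by apply: le_lt_trans (legendre_le a1 q0) _; rewrite ltrD2l ltr_pM2l.
Qed.

Lemma legendre_concave a b l : 1 <= a -> 1 <= b -> 0 <= l <= 1 ->
  l * legendre a + (1 - l) * legendre b <= legendre (l * a + (1 - l) * b).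
Proof.
move=> a1 b1 /andP[l0 l1]; apply: legendre_ge => q q0.
have := ler_wpM2l l0 (legendre_le a1 q0).
have l1' : 0 <= 1 - l by rewrite subr_ge0.
by have := ler_wpM2l l1' (legendre_le b1 q0); lra.
Qed.

Lemma legendre_le1 a : 1 <= a -> legendre a <= 1.
Proof.
move=> a1; apply/ler_addgt0Pl => e e0.
have a0 : 0 < a := lt_le_trans ltr01 a1.
have q0 : 0 < e / a by rewrite divr_gt0.
apply: le_trans (legendre_le a1 q0) _; rewrite divfK ?gt_eqF// addrC lerD2l.
exact/ltW/root_lt1.
Qed.

(** Fix q with root q > c. A parameter p <= q has a root at least as large; for p > q, [root_gtN]
    gives root p + p a > p (a - 1) >= 1, whence the threshold 1 + 1/q. *)
Lemma legendre_near1 c : c < 1 -> exists A, forall a, A <= a -> c < legendre a.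
Proof.
move=> c1; have [q q0 cq] := root_near1 c1.
exists (1 + q^-1) => a Aa; have a1 : 1 <= a by apply: le_trans Aa; rewrite lerDl invr_ge0 ltW.
apply: lt_le_trans cq _; apply: legendre_ge => p p0.
have [pq|qp] := leP p q.
  apply: le_trans (root_nincr p0 pq) _; rewrite lerDl mulr_ge0 ?(ltW p0)//.
  exact: le_trans a1.
apply: le_trans (ltW (root_lt1 q0)) _.
have := root_gtN p0.
have : q * q^-1 <= p * (a - 1).
  by rewrite ler_pM ?(ltW q0) ?invr_ge0 ?(ltW q0) ?(ltW qp)//; lra.
rewrite mulfV ?gt_eqF//; lra.
Qed.

End DimensionFunction.

(** * Analyticity *)

Section PowerSeriesNorm.
Context {R : realType}.
Variable r : R.
Hypothesis r0 : 0 < r.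
Implicit Types (A B D M N : R) (f g X Y : R -> R).

(* [psnorm_le M f]: on the disc of radius r, f is a power series whose l^1 norm
   with weights r^k is at most M. *)
Definition psnorm_le M f := exists c : nat -> R,
  (forall n, series (fun k => `|c k| * r ^+ k) n <= M) /\
  (forall z, `|z| <= r -> sums (fun k => c k * z ^+ k) (f z)).

Lemma psnorm_ge0 M f : psnorm_le M f -> 0 <= M.
Proof. by move=> [c [/(_ 0%N) + _]]; rewrite /series /= big_geq. Qed.

Lemma psnorm_bound M f z : psnorm_le M f -> `|z| <= r -> `|f z| <= M.
Proof.
move=> [c [cM h]] zr.
have [|s hs sM] := sums_bounded _ cM.
  by move=> n; rewrite mulr_ge0// exprn_ge0// ltW.
have [|u hu us] := @sums_dom _ (fun k => c k * z ^+ k) _ _ _ hs.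
  by move=> n; rewrite normrM normrX ler_wpM2l// lerXn2r ?nnegrE ?(ltW r0).
by rewrite (sums_unique (h z zr) hu) (le_trans us).
Qed.

Lemma psnorm_ext M f g : (forall z, `|z| <= r -> f z = g z) -> psnorm_le M f -> psnorm_le M g.
Proof.
by move=> fg [c [cM h]]; exists c; split=> // z zr; rewrite -fg//; exact: h.
Qed.

Lemma psnorm_weaken M N f : M <= N -> psnorm_le M f -> psnorm_le N f.
Proof. by move=> MN [c [cM h]]; exists c; split=> // n; exact: le_trans (cM n) MN. Qed.

Lemma sums_at0 (k : R) : sums (fun n => if n is 0%N then k else 0) k.
Proof.
split; apply: (@cvg_near_cst _ _ k); exists 1%N => // -[//|n] _ /=.
by rewrite /series /= big_nat_recl//= big1 ?addr0.
Qed.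

Lemma psnorm_cst k : psnorm_le `|k| (fun=> k).
Proof.
exists (fun n => if n is 0%N then k else 0); split => [[|n]|z zr].
- by rewrite /series /= big_geq.
- rewrite /series /= big_nat_recl//= big1 ?addr0 ?mulr1// => i _.
  by rewrite normr0 mul0r.
- by apply: eq_sums (sums_at0 k) => -[|n] /=; rewrite ?mulr1 ?mul0r.
Qed.

Lemma psnorm_0 : psnorm_le 0 (fun=> 0).
Proof. by have := psnorm_cst 0; rewrite normr0. Qed.

Lemma psnorm_add M N f g : psnorm_le M f -> psnorm_le N g -> psnorm_le (M + N) (fun z => f z + g z).
Proof.
move=> [c [cM hc]] [d [dM hd]]; exists (fun n => c n + d n); split => [n|z zr].
  apply: le_trans (lerD (cM n) (dM n)).
  rewrite /series /= -big_split/= ler_sum// => i _.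
  by rewrite -mulrDl ler_wpM2r ?exprn_ge0 ?(ltW r0)// ler_normD.
by apply: eq_sums (sumsD (hc z zr) (hd z zr)) => n; rewrite mulrDl.
Qed.

Lemma psnorm_scale k M f : psnorm_le M f -> psnorm_le (`|k| * M) (fun z => k * f z).
Proof.
move=> [c [cM hc]]; exists (fun n => k * c n); split => [n|z zr].
  apply: le_trans (ler_wpM2l (normr_ge0 k) (cM n)).
  by rewrite /series /= mulr_sumr ler_sum// => i _; rewrite normrM mulrA.
by apply: eq_sums (sumsZ k (hc z zr)) => n; rewrite mulrA.
Qed.

Lemma psnorm_opp M f : psnorm_le M f -> psnorm_le M (fun z => - f z).
Proof.
move=> /(psnorm_scale (-1)); rewrite normrN normr1 mul1r.
by apply: psnorm_ext => z _; rewrite mulN1r.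
Qed.

Lemma psnorm_sub M N f g : psnorm_le M f -> psnorm_le N g -> psnorm_le (M + N) (fun z => f z - g z).
Proof. by move=> hf hg; apply: psnorm_add hf (psnorm_opp hg). Qed.

Lemma psnorm_mulz M f : psnorm_le M f -> psnorm_le (r * M) (fun z => z * f z).
Proof.
move=> hf; have M0 := psnorm_ge0 hf; move: hf => [c [cM hc]].
exists (fun n => if n is k.+1 then c k else 0); split => [[|n]|z zr].
- by rewrite /series /= big_geq// mulr_ge0// ltW.
- rewrite /series /= big_nat_recl//= normr0 mul0r add0r.
  apply: le_trans (ler_wpM2l (ltW r0) (cM n)).
  by rewrite /series /= mulr_sumr ler_sum// => i _; rewrite exprS mulrCA.
- have [h] := sumsZ z (hc z zr); split.
  rewrite -cvg_shiftS; apply: cvg_trans h.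
  rewrite [X in X @ _](_ : _ = series (fun n => z * (c n * z ^+ n)))//.
  apply/funext => n; rewrite /series /= big_nat_recl//= mul0r add0r.
  by apply: eq_bigr => i _; rewrite exprS mulrCA.
Qed.

Lemma psnorm_id : psnorm_le r (fun z => z).
Proof.
have := psnorm_mulz (psnorm_cst 1); rewrite normr1 mulr1.
by apply: psnorm_ext => z _; rewrite mulr1.
Qed.

Lemma sums_series (c : nat -> nat -> R) (s : nat -> R) J :
  (forall j, sums (c j) (s j)) -> sums (fun k => series (c^~ k) J) (series s J).
Proof.
move=> h; elim: J => [|J IH].
  have s0 (u : nat -> R) : series u 0 = 0 by rewrite /series /= big_geq.
  by rewrite s0; apply: eq_sums (sums_at0 0) => -[|k]; rewrite s0.
rewrite seriesSr; apply: eq_sums (sumsD IH (h J)) => k.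
by rewrite seriesSr.
Qed.

Lemma cvg_partial_sums (u : nat -> nat -> R) (l : nat -> R) n :
  (forall k, u k J @[J --> \oo] --> l k) ->
  series (u^~ J) n @[J --> \oo] --> series l n.
Proof.
move=> h; elim: n => [|n IH].
  rewrite [X in _ --> X](_ : _ = 0); last by rewrite /series /= big_geq.
  by apply: cvg_near_cst; apply: nearW => J; rewrite /series /= big_geq.
rewrite seriesSr; under eq_cvg do rewrite seriesSr.
exact: cvgD.
Qed.

(** Completeness of the algebra; products, exponentials and limits of iterations all come from it.
    Coefficients are summed over j at fixed k, and the uniform bound [tail] justifies the exchange
    of the two sums. *)
Lemma psnorm_sum (M : nat -> R) B (f : nat -> R -> R) F :
  (forall j, psnorm_le (M j) (f j)) -> (forall n, series M n <= B) ->
  (forall z, `|z| <= r -> sums (f^~ z) (F z)) -> psnorm_le B F.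
Proof.
move=> hf MB hF; have M0 j : 0 <= M j := psnorm_ge0 (hf j).
have [T hT TB] := sums_bounded M0 MB.
have [c hc] := choice hf.
have cM j k : `|c j k| * r ^+ k <= M j.
  apply: le_trans ((hc j).1 k.+1); rewrite seriesSr lerDr.
  by rewrite /series /= sumr_ge0// => i _; rewrite mulr_ge0// exprn_ge0// ltW.
have rk k : 0 < r ^+ k by rewrite exprn_gt0.
have hC0 k : exists C, sums (c^~ k) C.
  have [|s hs _] := @sums_dom _ (c^~ k) _ _ _ (sumsZ (r ^+ k)^-1 hT).
    by move=> j; rewrite mulrC ler_pdivlMr.
  by exists s.
have [C hC] := choice hC0.
have tail J0 n : series (fun k => `|C k - series (c^~ k) J0| * r ^+ k) n <= T - series M J0.
  have h1 : series (fun k => `|series (c^~ k) J - series (c^~ k) J0| * r ^+ k) n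
      @[J --> \oo] --> series (fun k => `|C k - series (c^~ k) J0| * r ^+ k) n.
    apply: (cvg_partial_sums (u := fun k J => `|series (c^~ k) J - series (c^~ k) J0| * r ^+ k)) => k.
    apply: cvgMr_tmp; apply: cvg_norm; apply: cvgB; last exact: cvg_cst.
    by have [] := hC k.
  rewrite -(cvg_lim (@Rhausdorff R) h1); apply: limr_le; first exact: cvgP h1.
  exists J0 => // J /= J0J.
  apply: (@le_trans _ _ (series M J - series M J0)); last first.
    by rewrite lerD2r; exact: sums_ge.
  rewrite !sub_series_geq//.
  apply: (@le_trans _ _ (\sum_(J0 <= j < J) series (fun k => `|c j k| * r ^+ k) n)).
    rewrite /series /= exchange_big/=; apply: ler_sum => k _.
    rewrite -mulr_suml ler_wpM2r ?(ltW (rk k))//.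
    by rewrite sub_series_geq//; exact: ler_norm_sum.
  by apply: ler_sum => j _; exact: (hc j).1.
exists C; split => [n|z zr].
  apply: le_trans TB; have := tail 0%N n; rewrite [series M 0](_ : _ = 0) ?subr0; last first.
    by rewrite /series /= big_geq.
  apply: le_trans; apply: le_of_eq.
  by rewrite /series /=; apply: eq_bigr => k _; rewrite big_geq// subr0.
split; apply/cvgrPdist_le => e e0.
have e30 : 0 < e / 3 by rewrite divr_gt0.
have [/cvgrPdist_le/(_ _ e30)[J _ /(_ J (leqnn J))] /=] := hT.
move=> /(le_trans (ler_norm _)) TJ.
have FJ : `|F z - series (f^~ z) J| <= e / 3.
  have [h1] := hF z zr.
  have h2 : `|series (f^~ z) K - series (f^~ z) J| @[K --> \oo] --> `|F z - series (f^~ z) J|.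
    by apply: cvg_norm; apply: cvgB h1 _; exact: cvg_cst.
  rewrite -(cvg_lim (@Rhausdorff R) h2); apply: limr_le; first exact: cvgP h2.
  exists J => // K /= JK; apply: le_trans TJ.
  apply: (@le_trans _ _ (series M K - series M J)); last first.
    by rewrite lerD2r; exact: sums_ge.
  rewrite !sub_series_geq//; apply: le_trans (ler_norm_sum _ _ _) _.
  by apply: ler_sum => j _; exact: psnorm_bound (hf j) zr.
have [/cvgrPdist_le/(_ _ e30)] := @sums_series (fun j k => c j k * z ^+ k) (f^~ z) J (fun j => (hc j).2 z zr).
apply: filterS => n h.
have h3 : `|series (fun k => C k * z ^+ k) n - series (fun k => series (fun j => c j k * z ^+ k) J) n| <= e / 3.
  apply: le_trans TJ; apply: le_trans (tail J n).
  rewrite /series /= -sumrB; apply: le_trans (ler_norm_sum _ _ _) _.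
  apply: ler_sum => k _; rewrite -mulr_suml -mulrBl normrM normrX ler_wpM2l//.
  by rewrite lerXn2r ?nnegrE ?(ltW r0).
rewrite (_ : F z - _ = (F z - series (f^~ z) J) + (series (f^~ z) J - series (fun k => series (fun j => c j k * z ^+ k) J) n)
   - (series (fun k => C k * z ^+ k) n - series (fun k => series (fun j => c j k * z ^+ k) J) n)); last by ring.
apply: le_trans (ler_normB _ _) _; rewrite (_ : e = e / 3 + e / 3 + e / 3); last by field.
rewrite lerD//; apply: le_trans (ler_normD _ _) _; rewrite lerD//.
Qed.

(** Only the first factor is expanded: the product is the sum over j of the functions c_j z^j g(z),
    so [psnorm_sum] takes the place of a Cauchy product. *)
Lemma psnorm_mul M N f g : psnorm_le M f -> psnorm_le N g -> psnorm_le (M * N) (fun z => f z * g z).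
Proof.
move=> [c [cM hc]] hg; have N0 := psnorm_ge0 hg.
have hz j : psnorm_le (`|c j| * (r ^+ j * N)) (fun z => c j * (z ^+ j * g z)).
  apply: psnorm_scale; elim: j => [|j IH].
    by rewrite expr0 mul1r; apply: psnorm_ext hg => z _; rewrite mul1r.
  by rewrite exprS -mulrA; apply: psnorm_ext (psnorm_mulz IH) => z _; rewrite exprS mulrA.
apply: (psnorm_sum hz) => [n|z zr].
  rewrite /series /= (eq_bigr (fun k => (`|c k| * r ^+ k) * N)); last by move=> i _; rewrite mulrA.
  by rewrite -mulr_suml ler_wpM2r// cM.
rewrite mulrC; apply: eq_sums (sumsZ (g z) (hc z zr)) => k.
by rewrite mulrC mulrA.
Qed.

Lemma psnorm_pow k A X : psnorm_le A X -> psnorm_le (A ^+ k) (fun z => X z ^+ k).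
Proof.
move=> hX; elim: k => [|k IH]; first by have := psnorm_cst 1; rewrite normr1 expr0.
by rewrite exprS; apply: psnorm_ext (psnorm_mul hX IH) => z _; rewrite exprS.
Qed.

Lemma psnorm_pow_sub k A D X Y : psnorm_le A X -> psnorm_le A Y -> psnorm_le D (fun z => X z - Y z) ->
  psnorm_le (k%:R * A ^+ k.-1 * D) (fun z => X z ^+ k - Y z ^+ k).
Proof.
move=> hX hY hD; elim: k => [|k IH].
  by rewrite mul0r mul0r; apply: psnorm_ext psnorm_0 => z _; rewrite subrr.
apply: psnorm_ext (psnorm_weaken _ (psnorm_add (psnorm_mul hX IH) (psnorm_mul hD (psnorm_pow k hY)))).
  by move=> z _ /=; rewrite !exprS; ring.
rewrite /= -natr1; case: k {IH} => [|k] /=; first by rewrite !expr0; lra.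
by rewrite exprS; apply: le_of_eq; ring.
Qed.

End PowerSeriesNorm.

(** * Exponentials and fixed points in the algebra of power series *)

Section ExpAndFixpoint.
Context {R : realType}.
Variable r : R.
Hypothesis r0 : 0 < r.
Implicit Types (A B D M N : R) (f g X Y : R -> R).
Local Notation psnorm_le := (psnorm_le r).

Lemma sums_exp (x : R) : sums (exp_coeff x) (expR x).
Proof. exact/sums_lim/is_cvg_series_exp_coeff. Qed.

(** Its Lipschitz constant on the ball of radius A is e^A - 1, which vanishes with A; the
    contraction rests on this. *)
Definition exp_rem (x : R) : R := expR x - 1 - x.

Lemma sums_exp_rem (x : R) : sums (fun k => if (k < 2)%N then 0 else exp_coeff x k) (exp_rem x).
Proof.
have h1 := @sums_at0 R 1.
have h2 : sums (fun k : nat => if k == 1%N then x else 0) x.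
  split; apply: (@cvg_near_cst _ _ x); exists 2%N => // -[//|[//|n]] _ /=.
  by rewrite /series /= big_nat_recl// big_nat_recl//= big1 ?addr0 ?add0r.
apply: eq_sums (sumsB (sumsB (sums_exp x) h1) h2) => -[|[|k]] /=.
- by rewrite /exp_coeff /= expr0 fact0 divr1; ring.
- by rewrite /exp_coeff /= expr1 divr1; ring.
- by rewrite !subr0.
Qed.

Lemma psnorm_expR_sub A D X Y : psnorm_le A X -> psnorm_le A Y -> psnorm_le D (fun z => X z - Y z) ->
  psnorm_le (D * expR A) (fun z => expR (X z) - expR (Y z)).
Proof.
move=> hX hY hD; have D0 := psnorm_ge0 hD; have A0 := psnorm_ge0 hX.
have hz k : psnorm_le (`|k`!%:R^-1| * (k%:R * A ^+ k.-1 * D)) (fun z => k`!%:R^-1 * (X z ^+ k - Y z ^+ k)).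
  by apply: psnorm_scale; exact: psnorm_pow_sub.
apply: (psnorm_sum r0 hz) => [n|z zr].
  case: n => [|n]; first by rewrite /series /= big_geq// mulr_ge0// expR_ge0.
  rewrite /series /= big_nat_recl//= mul0r mul0r mulr0 add0r.
  apply: (@le_trans _ _ (D * series (exp_coeff A) n)); last first.
    by rewrite ler_wpM2l//; apply: sums_ge (sums_exp A) => i; exact: exp_coeff_ge0.
  rewrite /series /= mulr_sumr; apply: ler_sum => i _.
  rewrite ger0_norm ?invr_ge0// /exp_coeff /= factS natrM invfM.
  apply: le_of_eq; field.
  by rewrite nat1r !pnatr_eq0 -lt0n fact_gt0.
apply: eq_sums (sumsB (sums_exp (X z)) (sums_exp (Y z))) => k.
by rewrite /exp_coeff /= -mulrBl mulrC.
Qed.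

Lemma psnorm_exp_rem_sub A D X Y : psnorm_le A X -> psnorm_le A Y -> psnorm_le D (fun z => X z - Y z) ->
  psnorm_le (D * (expR A - 1)) (fun z => exp_rem (X z) - exp_rem (Y z)).
Proof.
move=> hX hY hD; have D0 := psnorm_ge0 hD; have A0 := psnorm_ge0 hX.
have e0 : 0 <= expR A - 1 by rewrite subr_ge0 -expR0 ler_expR.
have hz k : psnorm_le (if (k < 2)%N then 0 else `|k`!%:R^-1| * (k%:R * A ^+ k.-1 * D))
   (fun z => if (k < 2)%N then 0 else k`!%:R^-1 * (X z ^+ k - Y z ^+ k)).
  by case: ifP => _; [exact: psnorm_0|apply: psnorm_scale; exact: psnorm_pow_sub].
apply: (psnorm_sum r0 hz) => [n|z zr].
  case: n => [|[|n]]; first by rewrite /series /= big_geq// mulr_ge0.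
    by rewrite /series /= big_nat1 mulr_ge0.
  rewrite /series /= big_nat_recl// big_nat_recl//= !add0r.
  apply: (@le_trans _ _ (D * (series (exp_coeff A) n.+1 - 1))); last first.
    by rewrite ler_wpM2l// lerD2r; apply: sums_ge (sums_exp A) => i; exact: exp_coeff_ge0.
  have e00 : exp_coeff A 0 = 1 by rewrite /exp_coeff /= expr0 fact0 divr1.
  rewrite /series [X in D * (X - _)]big_nat_recl// e00 addrAC subrr add0r.
  rewrite mulr_sumr; apply: ler_sum => i _.
  rewrite ger0_norm ?invr_ge0// /exp_coeff /= [i.+2`!]factS natrM invfM.
  apply: le_of_eq; field.
  by rewrite -(natrD _ 2) !pnatr_eq0 -lt0n fact_gt0.
apply: eq_sums (sumsB (sums_exp_rem (X z)) (sums_exp_rem (Y z))) => k.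
by case: ifP => _; rewrite ?subrr// /exp_coeff /= -mulrBl mulrC.
Qed.

(** Picard iteration from 0: the first step has norm at most rho/2 and each later one is at most
    half as long, so the iterates never leave the ball. The index type carries a system of
    unknowns. *)
Lemma psnorm_fixpoint (I : Type) (Phi : (I -> R -> R) -> I -> R -> R) (rho : R) :
  (forall i, psnorm_le (rho / 2) (Phi (fun _ _ => 0) i)) ->
  (forall F G D, (forall i, psnorm_le rho (F i)) -> (forall i, psnorm_le rho (G i)) ->
     (forall i, psnorm_le D (fun z => F i z - G i z)) ->
     forall i, psnorm_le (D / 2) (fun z => Phi F i z - Phi G i z)) ->
  exists2 F, (forall i, psnorm_le rho (F i)) & forall i z, `|z| <= r -> F i z = Phi F i z.
Proof.
move=> h0 hL; pose u n := iter n Phi (fun _ _ => 0).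
(* Without an index, [rho] could be negative and the claim is vacuous. *)
have [[i0]|noI] := pselect (inhabited I); last first.
  by exists (fun _ _ => 0) => i; exfalso; apply: noI; exists.
have rho0 : 0 <= rho by have := psnorm_ge0 (h0 i0); rewrite pmulr_lge0 ?invr_gt0.
have half : 0 <= 2^-1 ^+ _ :> R by move=> n; rewrite exprn_ge0.
have hu n : (forall i, psnorm_le (rho * (1 - 2^-1 ^+ n)) (u n i)) /\
            (forall i, psnorm_le (rho * 2^-1 ^+ n.+1) (fun z => u n.+1 i z - u n i z)).
  elim: n => [|n [IH1 IH2]].
    split => i; first by rewrite expr0 subrr mulr0; exact: psnorm_0.
    by rewrite expr1; apply: psnorm_ext (h0 i) => z _; rewrite subr0.
  have IH3 i : psnorm_le (rho * (1 - 2^-1 ^+ n.+1)) (u n.+1 i).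
    apply: psnorm_ext (psnorm_weaken _ (psnorm_add r0 (IH1 i) (IH2 i))) => [z _|]; first by ring.
    by apply: le_of_eq; rewrite exprS; field.
  split=> // i.
  have sm m j : psnorm_le (rho * (1 - 2^-1 ^+ m)) (u m j) -> psnorm_le rho (u m j).
    by apply: psnorm_weaken; rewrite ler_piMr// gerBl.
  have := hL (u n.+1) (u n) _ (fun j => sm _ _ (IH3 j)) (fun j => sm _ _ (IH1 j)) IH2 i.
  by rewrite -mulrA -exprSr.
pose dl i n z := u n.+1 i z - u n i z.
pose F i z := limn (series (fun n => dl i n z)).
have half_sum (N n : nat) : series (fun k => rho * 2^-1 ^+ (N + k).+1) n <= rho * 2^-1 ^+ N.
  rewrite (_ : series _ n = rho * 2^-1 ^+ N * series (fun k => 2^-1 ^+ k.+1) n); last first.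
    by rewrite /series /= mulr_sumr; apply: eq_bigr => k _; rewrite -addnS exprD mulrA.
  by rewrite ler_piMr ?mulr_ge0//; apply: sums_ge (@sums_half R).
have hF i z : `|z| <= r -> sums (fun n => dl i n z) (F i z).
  move=> zr; have [|s hs _] := @sums_dom _ (fun n => dl i n z) _ _ _ (sumsZ rho (@sums_half R)).
    by move=> n; exact: psnorm_bound ((hu n).2 i) zr.
  by rewrite /F (lim_sums hs).
have sdl i z n : series (fun k => dl i k z) n = u n i z.
  elim: n => [|n IH]; first by rewrite /series /= big_geq.
  by rewrite seriesSr IH /dl addrC subrK.
have hFN (N : nat) i : psnorm_le (rho * 2^-1 ^+ N) (fun z => F i z - u N i z).
  apply: (psnorm_sum r0 (f := fun n => dl i (N + n)%N) (fun n => (hu (N + n)%N).2 i)) => // z zr.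
  have [h] := hF i z zr; split.
  rewrite (_ : series _ = fun n => series (fun k => dl i k z) (n + N)%N - u N i z).
    by apply: cvgB; [rewrite (@cvg_shiftn N)|exact: cvg_cst].
  apply/funext => n; rewrite sdl; elim: n => [|n IH].
    by rewrite add0n subrr /series /= big_geq.
  by rewrite seriesSr IH /dl addSn (addnC N); ring.
have Frho i : psnorm_le rho (F i).
  by apply: psnorm_ext (psnorm_weaken _ (hFN 0%N i)) => [z _|]; rewrite ?subr0// expr0 mulr1.
exists F => // i z zr; apply/eqP; rewrite -subr_eq0 -normr_le0; apply/ler_addgt0Pl => e e0.
rewrite addr0.
have [N hN] : exists N : nat, rho * 2^-1 ^+ N <= e.
  have := @cvg_geometric R rho 2^-1.
  rewrite ger0_norm ?invr_ge0// invf_lt1// ltr1n => /(_ isT)/cvgrPdist_le/(_ _ e0)[N _ /(_ N (leqnn N))].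
  by rewrite /= sub0r normrN => h; exists N; exact: le_trans (ler_norm _) h.
have sm j : psnorm_le rho (u N j) by apply: psnorm_weaken ((hu N).1 j); rewrite ler_piMr// gerBl.
have h1 := psnorm_bound r0 (hL F (u N) _ Frho sm (hFN N) i) zr.
have h2 := psnorm_bound r0 (hFN N.+1 i) zr.
rewrite (_ : F i z - _ = (F i z - u N.+1 i z) - (Phi F i z - Phi (u N) i z)); last first.
  by rewrite /u /=; ring.
apply: le_trans (ler_normB _ _) _; apply: le_trans (lerD h2 h1) _.
by apply: le_trans hN; apply: le_of_eq; rewrite exprS; field.
Qed.

End ExpAndFixpoint.

(** * Expansion of the Legendre transform around a critical point *)

Section LegendreAnalytic.
Context {R : realType}.
Local Notation len := (@len R).
Local Notation wt := (@wt R).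
Local Notation root := (@pressure_root R).

Lemma root_unique (t q : R) : 0 < q -> pressure t q = 1 -> root q = t.
Proof.
move=> q0 h; have [u [_ hu]] := pressure_sum_unique q0.
rewrite -(hu (root q)) ?pressure_rootP//.
by apply: hu; rewrite pressure_sum_pressure// h.
Qed.

Section Local.
Variables (a q0 : R).
Hypothesis a1 : 1 < a.
Hypothesis q0_gt0 : 0 < q0.
Hypothesis drift0 : drift a (root q0) q0 = 0.

Let t0 := root q0.
Let p n := bterm t0 q0 n.
Let k n := wt n - a * len n.
(** A bound for (len + |k|) / wt, hence for the size of a phase relative to its weight. *)
Let c := 2 + a.
Let hq : 0 < q0 / 2. Proof. by rewrite divr_gt0. Qed.

Let phase (F : bool -> R -> R) n z := - (F true z * len n + F false z * k n).

Lemma expR_sub1_le (x : R) : expR x - 1 <= x * expR x.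
Proof.
have := expR_ge1Dx (- x); rewrite expRN -(ler_pM2l (expR_gt0 x)) mulfV ?gt_eqF ?expR_gt0//; lra.
Qed.

Lemma drift_coef_le n : `|k n| <= (1 + a) * wt n.
Proof.
rewrite /k; apply: le_trans (ler_normB _ _) _.
rewrite normrM (ger0_norm (ltW (wt_gt0 n))) (ger0_norm (ltW (len_gt0 n))).
rewrite (ger0_norm (ltW (lt_trans ltr01 a1))) mulrDl mul1r lerD2l ler_wpM2l ?len_le_wt//.
exact/ltW/lt_trans/a1.
Qed.

Section Bounds.
Variables (r rho : R).
Hypotheses (r0 : 0 < r) (rho0 : 0 <= rho) (rho_small : rho * c <= q0 / 2 * ln 2).
Local Notation psnorm_le := (psnorm_le r).

Lemma psnorm_phase D F G : (forall i, psnorm_le D (fun z => F i z - G i z)) ->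
  forall n, psnorm_le (D * c * wt n) (fun z => phase F n z - phase G n z).
Proof.
move=> hD n; have D0 := psnorm_ge0 (hD true).
have h1 := psnorm_scale (len n) (hD true); have h2 := psnorm_scale (k n) (hD false).
apply: psnorm_ext (psnorm_weaken _ (psnorm_opp (psnorm_add r0 h1 h2))).
  by move=> z _; rewrite /phase; ring.
rewrite (ger0_norm (ltW (len_gt0 n))) -mulrDl mulrC -mulrA ler_wpM2l//.
have := drift_coef_le n; have := len_le_wt n : len n <= wt n; rewrite /c; lra.
Qed.

Lemma psnorm_phase0 F : (forall i, psnorm_le rho (F i)) -> forall n, psnorm_le (rho * c * wt n) (phase F n).
Proof.
move=> hF n; have hF0 i : psnorm_le rho (fun z => F i z - (fun _ _ => 0 : R) i z).
  by apply: psnorm_ext (hF i) => z _; rewrite subr0.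
have := psnorm_phase hF0 n; apply: psnorm_ext => z _.
by rewrite /phase !mul0r addr0 oppr0 subr0.
Qed.

(** The purpose of [rho_small]: the exponential of a phase is paid with half of the decay rate
    q0. *)
Let p_expR n : p n * expR (rho * c * wt n) <= bterm t0 (q0 / 2) n.
Proof.
rewrite /p (bterm_shift t0 (q0 / 2)) -mulrA ger_pMr ?bterm_gt0// -expRD expR_le1.
rewrite subrr mul0r add0r.
have := ler_wpM2r (ltW (wt_gt0 n)) rho_small.
move: (wt n) => w; rewrite (_ : q0 - q0 / 2 = q0 / 2); last by field.
lra.
Qed.

Let Srem g F z := limn (series (fun n => p n * g n * exp_rem (phase F n z))).
Let Sexp g F z := limn (series (fun n => p n * g n * (expR (phase F n z) - 1))).

Lemma psnorm_exp_rem_term g D F G : (forall i, psnorm_le rho (F i)) -> (forall i, psnorm_le rho (G i)) ->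
  (forall i, psnorm_le D (fun z => F i z - G i z)) ->
  forall n, psnorm_le (D * rho * c ^+ 2 * (`|g n| * wt n * wt n * bterm t0 (q0 / 2) n))
     (fun z => p n * g n * exp_rem (phase F n z) - p n * g n * exp_rem (phase G n z)).
Proof.
move=> hF hG hD n; have D0 := psnorm_ge0 (hD true).
have := psnorm_scale (p n * g n) (psnorm_exp_rem_sub r0 (psnorm_phase0 hF n) (psnorm_phase0 hG n) (psnorm_phase hD n)).
move=> h; apply: psnorm_ext (psnorm_weaken _ h) => [z _|]; first by rewrite mulrBr.
have A0 : 0 <= rho * c * wt n.
  by rewrite !mulr_ge0// ?(ltW (wt_gt0 n))// /c; move: a1; lra.
rewrite normrM (ger0_norm (bterm_ge0 _ _ n)).
have c0 : 0 <= c by rewrite /c; move: a1; lra.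
apply: (@le_trans _ _ (p n * `|g n| * (D * c * wt n * (rho * c * wt n * expR (rho * c * wt n))))).
  rewrite ler_wpM2l ?mulr_ge0 ?bterm_ge0// ler_wpM2l ?mulr_ge0 ?(ltW (wt_gt0 n))//.
  exact: expR_sub1_le.
rewrite [leLHS](_ : _ = (D * rho * c ^+ 2 * (`|g n| * wt n * wt n)) * (p n * expR (rho * c * wt n))); last by ring.
rewrite [leRHS](_ : _ = (D * rho * c ^+ 2 * (`|g n| * wt n * wt n)) * bterm t0 (q0 / 2) n); last by ring.
by rewrite ler_wpM2l ?p_expR// !mulr_ge0 ?exprn_ge0 ?(ltW (wt_gt0 n)).
Qed.

Lemma psnorm_expR_term g D F G : (forall i, psnorm_le rho (F i)) -> (forall i, psnorm_le rho (G i)) ->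
  (forall i, psnorm_le D (fun z => F i z - G i z)) ->
  forall n, psnorm_le (D * c * (`|g n| * wt n * bterm t0 (q0 / 2) n))
     (fun z => p n * g n * (expR (phase F n z) - 1) - p n * g n * (expR (phase G n z) - 1)).
Proof.
move=> hF hG hD n; have D0 := psnorm_ge0 (hD true).
have := psnorm_scale (p n * g n) (psnorm_expR_sub r0 (psnorm_phase0 hF n) (psnorm_phase0 hG n) (psnorm_phase hD n)).
move=> h; apply: psnorm_ext (psnorm_weaken _ h) => [z _|]; first by ring.
rewrite normrM (ger0_norm (bterm_ge0 _ _ n)).
rewrite [leLHS](_ : _ = (D * c * (`|g n| * wt n)) * (p n * expR (rho * c * wt n))); last by rewrite /p; ring.
rewrite [leRHS](_ : _ = (D * c * (`|g n| * wt n)) * bterm t0 (q0 / 2) n); last by ring.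
by rewrite ler_wpM2l ?p_expR// !mulr_ge0 ?(ltW (wt_gt0 n))// /c; move: a1; lra.
Qed.

(** Comparing F with the zero family, where all terms vanish, gives convergence; comparing F with G
    gives the Lipschitz bound. *)
Lemma psnorm_series_sub (h : nat -> R -> R) (M : nat -> R) (K : R) : 0 <= K -> expgrowth M ->
  (forall n, 0 <= M n) -> (forall n, h n 0 = 0) ->
  (forall D F G, (forall i, psnorm_le rho (F i)) -> (forall i, psnorm_le rho (G i)) ->
    (forall i, psnorm_le D (fun z => F i z - G i z)) ->
    forall n, psnorm_le (D * K * (M n * bterm t0 (q0 / 2) n))
     (fun z => h n (phase F n z) - h n (phase G n z))) ->
  let S F z := limn (series (fun n => h n (phase F n z))) in
  (forall F, (forall i, psnorm_le rho (F i)) -> forall z, `|z| <= r ->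
    sums (fun n => h n (phase F n z)) (S F z)) /\
  (forall D F G, (forall i, psnorm_le rho (F i)) -> (forall i, psnorm_le rho (G i)) ->
    (forall i, psnorm_le D (fun z => F i z - G i z)) ->
    psnorm_le (D * (K * moment M t0 (q0 / 2))) (fun z => S F z - S G z)).
Proof.
move=> K0 eM M0 h0 H S; have hM := moment_sums t0 hq eM.
have phase00 n z : phase (fun _ _ => 0) n z = 0 by rewrite /phase; ring.
have hS F : (forall i, psnorm_le rho (F i)) -> forall z, `|z| <= r -> sums (fun n => h n (phase F n z)) (S F z).
  move=> hF z zr; pose Z (i : bool) (y : R) := 0 : R.
  have hZ i : psnorm_le rho (Z i) by apply: psnorm_weaken rho0 (psnorm_0 _).
  have hF0 i : psnorm_le rho (fun z => F i z - Z i z).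
    by apply: psnorm_ext (hF i) => y _; rewrite subr0.
  have [|s hs _] := @sums_dom _ (fun n => h n (phase F n z)) _ _ _ (sumsZ (rho * K) hM).
    move=> n; have := psnorm_bound r0 (H rho F Z hF hZ hF0 n) zr.
    by rewrite phase00 h0 subr0.
  by rewrite /S (lim_sums hs).
split=> // D F G hF hG hD; have D0 := psnorm_ge0 (hD true).
apply: (psnorm_sum r0 (H D F G hF hG hD)) => [n|z zr]; last exact: sumsB (hS F hF z zr) (hS G hG z zr).
rewrite mulrA; apply: sums_ge (sumsZ (D * K) hM) => i.
by rewrite !mulr_ge0 ?bterm_ge0.
Qed.

Lemma expgrowth_absww g : expgrowth g -> expgrowth (fun n => `|g n| * wt n * wt n).
Proof. by move=> eg; do 2 (apply: expgrowth_mul; last exact: expgrowth_wt); exact: expgrowth_abs. Qed.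

Lemma expgrowth_absw g : expgrowth g -> expgrowth (fun n => `|g n| * wt n).
Proof. by move=> eg; apply: expgrowth_mul; [exact: expgrowth_abs|exact: expgrowth_wt]. Qed.

Lemma psnorm_rem_series_sub g : expgrowth g ->
  let S F z := limn (series (fun n => p n * g n * exp_rem (phase F n z))) in
  (forall F, (forall i, psnorm_le rho (F i)) -> forall z, `|z| <= r ->
    sums (fun n => p n * g n * exp_rem (phase F n z)) (S F z)) /\
  (forall D F G, (forall i, psnorm_le rho (F i)) -> (forall i, psnorm_le rho (G i)) ->
    (forall i, psnorm_le D (fun z => F i z - G i z)) ->
    psnorm_le (D * (rho * c ^+ 2 * moment (fun n => `|g n| * wt n * wt n) t0 (q0 / 2)))
       (fun z => S F z - S G z)).
Proof.
move=> eg; apply: (@psnorm_series_sub (fun n x => p n * g n * exp_rem x) (fun n => `|g n| * wt n * wt n)).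
- by rewrite mulr_ge0// exprn_ge0// /c; move: a1; lra.
- exact: expgrowth_absww.
- by move=> n; rewrite !mulr_ge0 ?(ltW (wt_gt0 n)).
- by move=> n; rewrite /exp_rem expR0 subrr subr0 mulr0.
- by move=> D F G hF hG hD n; rewrite [_ * (rho * _)]mulrA; exact: psnorm_exp_rem_term.
Qed.

Lemma psnorm_exp_series_sub g : expgrowth g ->
  let S F z := limn (series (fun n => p n * g n * (expR (phase F n z) - 1))) in
  (forall F, (forall i, psnorm_le rho (F i)) -> forall z, `|z| <= r ->
    sums (fun n => p n * g n * (expR (phase F n z) - 1)) (S F z)) /\
  (forall D F G, (forall i, psnorm_le rho (F i)) -> (forall i, psnorm_le rho (G i)) ->
    (forall i, psnorm_le D (fun z => F i z - G i z)) ->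
    psnorm_le (D * (c * moment (fun n => `|g n| * wt n) t0 (q0 / 2)))
       (fun z => S F z - S G z)).
Proof.
move=> eg; apply: (@psnorm_series_sub (fun n x => p n * g n * (expR x - 1)) (fun n => `|g n| * wt n)).
- by rewrite /c; move: a1; lra.
- exact: expgrowth_absw.
- by move=> n; rewrite !mulr_ge0 ?(ltW (wt_gt0 n)).
- by move=> n; rewrite expR0 subrr mulr0.
- by move=> D F G hF hG hD n; exact: psnorm_expR_term.
Qed.

End Bounds.

Let Lam := moment len t0 q0.
Let B := moment (fun n => k n * len n) t0 q0.
Let sig := moment (fun n => k n * k n) t0 q0.
Let one (n : nat) : R := 1.
Let Srem g (F : bool -> R -> R) z : R := limn (series (fun n => p n * g n * exp_rem (phase F n z))).
Let Sexp g (F : bool -> R -> R) z : R := limn (series (fun n => p n * g n * (expR (phase F n z) - 1))).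

(* Pressure 1 and drift 0, expanded to first order around (t0, q0) in the
   coordinates w = ln 2 * (u + a * v'), v = ln 2 * v', where (u, v') is the
   displacement of (t, q) and the term of index n is multiplied by exp (phase n). *)
Let Phi (F : bool -> R -> R) (i : bool) (z : R) : R :=
  if i then Lam^-1 * Srem one F z
  else sig^-1 * ((Srem k F z - B * (Lam^-1 * Srem one F z)) - z * (Lam + Sexp len F z)).

Let expgrowth_k : expgrowth k := expgrowth_drift a.
Let Lam_gt0 : 0 < Lam.
Proof. exact: lt_le_trans (moment_len_ge1 q0_gt0 (pressure_root1 q0_gt0)). Qed.

(** The linear part of the system is triangular, since zero drift removes v from the pressure
    equation, and its diagonal is [Lam], [sig]. Positivity of [sig] is read off the first block,
    where k is 1 - a. *)
Let sig_gt0 : 0 < sig.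
Proof.
have ekk : expgrowth (fun n => k n * k n) by exact: expgrowth_mul.
apply: lt_le_trans (sums_ge 1 _ (moment_sums t0 q0_gt0 ekk)); last first.
  by move=> n; rewrite mulr_ge0 ?bterm_ge0// -expr2 sqr_ge0.
rewrite /series /= big_nat1 mulr_gt0 ?bterm_gt0// -expr2 exprn_even_gt0//=.
have -> : k 0 = 1 - a by rewrite /k /wt /len expr1; ring.
by rewrite subr_eq0 lt_eqF.
Qed.

Lemma legendre_local : exists r M, 0 < r /\ psnorm_le r M (fun z => legendre (a + z)).
Proof.
have l2 := @ln2_gt0 R.
have c3 : 3 <= c by rewrite /c; move: a1; lra.
have c0 : 0 < c by lra.
pose S1 := moment (fun n => `|one n| * wt n * wt n) t0 (q0 / 2).
pose S2 := moment (fun n => `|k n| * wt n * wt n) t0 (q0 / 2).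
pose S3 := moment (fun n => `|len n| * wt n) t0 (q0 / 2).
have eone : expgrowth one := expgrowth_cst 1.
have ww0 (g : nat -> R) n : 0 <= `|g n| * wt n * wt n by rewrite !mulr_ge0 ?(ltW (wt_gt0 n)).
have w0 (g : nat -> R) n : 0 <= `|g n| * wt n by rewrite !mulr_ge0 ?(ltW (wt_gt0 n)).
have mom0 g : expgrowth g -> (forall n, 0 <= g n) -> 0 <= moment g t0 (q0 / 2).
  move=> eg g0; apply: le_trans (sums_ge 0 _ (moment_sums t0 hq eg)).
    by rewrite /series /= big_geq.
  by move=> n; rewrite mulr_ge0 ?bterm_ge0.
have S10 : 0 <= S1 by apply: mom0 => //; exact: expgrowth_absww.
have S20 : 0 <= S2 by apply: mom0 => //; exact: expgrowth_absww.
have S30 : 0 <= S3 by apply: mom0 => //; exact/expgrowth_absw/expgrowth_len.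
have Li0 : 0 <= Lam^-1 by rewrite invr_ge0 ltW.
have si0 : 0 <= sig^-1 by rewrite invr_ge0 ltW.
pose C1 := Lam^-1 * (c ^+ 2 * S1); pose C2 := sig^-1 * (c ^+ 2 * S2 + `|B| * C1).
pose C3 := sig^-1 * (c * S3).
have cc0 : 0 <= c ^+ 2 by rewrite exprn_ge0// ltW.
have C10 : 0 <= C1 by rewrite /C1 mulr_ge0// mulr_ge0.
have C20 : 0 <= C2 by rewrite /C2 mulr_ge0// addr_ge0 1?mulr_ge0.
have C30 : 0 <= C3 by rewrite /C3 mulr_ge0// mulr_ge0// ltW.
have aux (x y z : R) : 0 <= x -> 0 <= y -> 0 <= z -> x * (4 * (y + z + 1)) <= 1 -> x * y <= 4^-1.
  by move=> x0 y0 z0 h; rewrite -[leRHS]mul1r ler_pdivlMr//; nra.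
(* The first bound is [rho_small]; the second lets the remainder terms contribute at most 1/4 to the
   contraction factor. *)
pose rho := Num.min (q0 / 2 * ln 2 / c) (4 * (C1 + C2 + 1))^-1.
have rho0 : 0 < rho.
  by rewrite lt_min divr_gt0 ?mulr_gt0// invr_gt0 mulr_gt0//; lra.
have rho1 : rho * c <= q0 / 2 * ln 2 by rewrite -ler_pdivlMr// ge_min lexx.
have rho2 : rho * (4 * (C1 + C2 + 1)) <= 1.
  by rewrite -ler_pdivlMr ?mul1r ?ge_min ?lexx ?orbT//; lra.
(* In order: the factor z in the drift equation contributes at most 1/4, the image of 0, namely - z
   Lam / sig, has norm at most rho/2, and a + z >= 1. *)
pose r := Num.min (Num.min (4 * (C3 + 1))^-1 (rho / (2 * (sig^-1 * Lam + 1)))) (a - 1).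
have sL0 : 0 <= sig^-1 * Lam := mulr_ge0 si0 (ltW Lam_gt0).
have r0 : 0 < r.
  rewrite !lt_min subr_gt0 a1 invr_gt0 mulr_gt0/= ?divr_gt0 ?mulr_gt0 ?andbT//; lra.
have r1 : r * (4 * (C3 + 1)) <= 1.
  by rewrite -ler_pdivlMr ?mul1r ?ge_min ?lexx//; lra.
have r2 : r * (2 * (sig^-1 * Lam + 1)) <= rho.
  by rewrite -ler_pdivlMr ?ge_min ?lexx ?orbT//; lra.
have r3 : r <= a - 1 by rewrite ge_min lexx orbT.
have [s1 d1] := psnorm_rem_series_sub r0 (ltW rho0) rho1 eone.
have [s2 d2] := psnorm_rem_series_sub r0 (ltW rho0) rho1 expgrowth_k.
have [s3 d3] := psnorm_exp_series_sub r0 (ltW rho0) rho1 (@expgrowth_len R).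
have [] := @psnorm_fixpoint R r r0 bool Phi rho.
- have phase00 n z : phase (fun _ _ => 0) n z = 0 by rewrite /phase; ring.
  have lim0 : limn (series (fun=> 0 : R)) = 0.
    by apply: lim_sums; apply: eq_sums (sums_at0 0) => -[].
  have SR0 g z : Srem g (fun _ _ => 0) z = 0.
    rewrite /Srem -[RHS]lim0; congr (limn (series _)); apply/funext => n.
    by rewrite phase00 /exp_rem expR0 subrr subr0 mulr0.
  have SE0 g z : Sexp g (fun _ _ => 0) z = 0.
    rewrite /Sexp -[RHS]lim0; congr (limn (series _)); apply/funext => n.
    by rewrite phase00 expR0 subrr mulr0.
  case.
    apply: psnorm_weaken (divr_ge0 (ltW rho0) _) _ => //.
    by apply: psnorm_ext (psnorm_0 _) => z _; rewrite /Phi SR0 mulr0.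
  apply: psnorm_ext (psnorm_weaken _ (psnorm_scale (- (sig^-1 * Lam)) (psnorm_id r0))) => [z _|].
    by rewrite /Phi !SR0 SE0; ring.
  by rewrite normrN ger0_norm// ler_pdivlMr//; move: r2; move: r0; lra.
- move=> F G D hF hG hD.
  have D0 := psnorm_ge0 (hD true).
  have e1 := psnorm_scale (Lam^-1) (d1 D F G hF hG hD).
  (* This bound serves again in the equation for v, where [Phi] has w replaced by its right-hand
     side: the linear term B w itself has no small Lipschitz constant. *)
  have h1 : psnorm_le r (D * (rho * C1)) (fun z => Phi F true z - Phi G true z).
    apply: psnorm_ext (psnorm_weaken _ e1) => [z _|]; first by rewrite /Phi -mulrBr.
    by rewrite ger0_norm//; apply: le_of_eq; rewrite /C1 /S1; ring.
  case.
    apply: psnorm_weaken h1; rewrite ler_wpM2l//.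
    by apply: le_trans (aux _ _ _ (ltW rho0) C10 C20 rho2) _; rewrite lef_pV2 ?posrE// ler_nat.
  have e2 := psnorm_scale (sig^-1) (psnorm_sub r0 (psnorm_sub r0 (d2 D F G hF hG hD) (psnorm_scale B h1))
     (psnorm_mulz r0 (d3 D F G hF hG hD))).
  apply: psnorm_ext (psnorm_weaken _ e2) => [z _|]; first by rewrite /Phi /Srem /Sexp; ring.
  rewrite ger0_norm// -/S2 -/S3.
  rewrite [leLHS](_ : _ = D * (rho * C2 + r * C3)); last by rewrite /C2 /C3; ring.
  rewrite ler_wpM2l//.
  have : rho * C2 <= 4^-1.
    by apply: (aux _ _ _ (ltW rho0) C20 C10); rewrite (addrC C2).
  have : r * C3 <= 4^-1.
    by apply: (aux r C3 0 (ltW r0) C30 (lexx 0)); rewrite addr0.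
  lra.
move=> F hF eqF; exists r; eexists; split => //.
have hw := psnorm_scale (ln 2)^-1 (hF true); have hv := psnorm_scale (ln 2)^-1 (hF false).
(* This is t + q (a + z) written in w and v; the terms in a v cancel. *)
have hall := psnorm_add r0 (psnorm_add r0 (psnorm_add r0 (psnorm_cst r (t0 + q0 * a)) (psnorm_scale q0 (psnorm_id r0))) hw)
   (psnorm_mulz r0 hv).
apply: psnorm_ext hall => z zr.
have := eqF true z zr; have := eqF false z zr; rewrite /Phi.
have := s1 F hF z zr; rewrite -/(Srem one F z).
have := s2 F hF z zr; rewrite -/(Srem k F z).
have := s3 F hF z zr; rewrite -/(Sexp len F z).
have vr : `|F false z| <= rho := psnorm_bound r0 (hF false) zr.
pose w := F true z; pose v := F false z; rewrite -/w -/v in vr *.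
move: (Srem one F z) (Srem k F z) (Sexp len F z) => A1 A2 A3 h3 h2 h1 ev ew.
have hA1 : A1 = Lam * w by rewrite ew mulrA mulfV ?mul1r ?gt_eqF.
have hA2 : A2 = sig * v + B * w + z * (Lam + A3).
  by rewrite ev mulrA mulfV ?mul1r ?gt_eqF// -ew; ring.
pose t := t0 + (w - a * v) / ln 2; pose q := q0 + v / ln 2.
have q_gt0 : 0 < q.
  have : `|v| * 3 <= q0 / 2 * ln 2.
    by apply: le_trans rho1; rewrite ler_pM.
  rewrite /q; have := ler_norm (- v); rewrite normrN => hv1 hv2.
  have : - (v / ln 2) * 3 <= q0 / 2.
    by rewrite -mulNr -mulrA (mulrC _ 3) mulrA ler_pdivrMr//; lra.
  by move: q0_gt0; lra.
have bt n : bterm t q n = p n * expR (phase F n z).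
  rewrite (bterm_shift t0 q0) /t /q /phase -/w -/v /k; congr (_ * expR _).
  by field; rewrite gt_eqF.
have phE n : phase F n z = - (w * len n + v * k n) by [].
have hL := moment_sums t0 q0_gt0 (@expgrowth_len R).
have hK : sums (fun n => k n * p n) 0 by rewrite -drift0; exact: moment_sums.
have hP : sums p 1 by rewrite -(pressure_root1 q0_gt0); exact: pressure_sums.
have P1 : pressure t q = 1.
  apply: (sums_unique (pressure_sums t q_gt0)).
  have := sumsD (sumsB (sumsB hP (sumsZ w hL)) (sumsZ v hK)) h1.
  rewrite (_ : 1 - _ - _ + _ = 1); last by rewrite hA1 /Lam; ring.
  by apply: eq_sums => n; rewrite bt /exp_rem; move: (expR _) => e; rewrite phE /one /p; ring.
have rt : root q = t := root_unique q_gt0 P1.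
have hB : sums (fun n => k n * len n * p n) B.
  by apply: moment_sums => //; apply: expgrowth_mul => //; exact: expgrowth_len.
have hS : sums (fun n => k n * k n * p n) sig by apply: moment_sums => //; exact: expgrowth_mul.
have D1 : drift (a + z) (root q) q = 0.
  rewrite rt; apply: (sums_unique (drift_sums (a + z) t q_gt0)).
  have := sumsB (sumsB (sumsB (sumsD hK h2) (sumsZ w hB)) (sumsZ v hS)) (sumsZ z (sumsD hL h3)).
  rewrite (_ : _ - z * _ = 0); last by rewrite hA2 /Lam; ring.
  by apply: eq_sums => n; rewrite bt /exp_rem; move: (expR _) => e; rewrite phE /k /p; ring.
rewrite (legendre_critical _ q_gt0 D1) ?rt.
  by rewrite /t /q -/w -/v; field; rewrite gt_eqF.
by move: zr r3; rewrite ler_norml => /andP[]; lra.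
Qed.

End Local.

Lemma legendre_analytic (a : R) : 1 < a -> exists (c : nat -> R) (r : R), 0 < r /\
  forall x, `|x - a| < r -> pseries c (x - a) n @[n --> \oo] --> legendre x.
Proof.
move=> a1; have [q q0 hq] := critical_point a1.
have [r [M [r0 [c [_ hc]]]]] := legendre_local a1 q0 hq.
exists c, r; split => // x xr; have [h] := hc _ (ltW xr).
by rewrite (_ : a + (x - a) = x) in h; last by ring.
Qed.

End LegendreAnalytic.

(** * Coding by words and upper bound *)

Section Words.
Context {R : realType}.
Implicit Types (v w : seq nat) (x z : R) (n : nat).

(* The letter n stands for the block of n zeros followed by a one, of length
   n + 1 and Birkhoff weight 2^n + ... + 1. *)
Definition wlen w : nat := \sum_(n <- w) n.+1.
Definition wwt w : nat := \sum_(n <- w) (2 ^ n.+1 - 1).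

(* The binary number whose digits are those of the word. *)
Fixpoint wcode w : nat := if w is n :: v then (2 ^ wlen v + wcode v)%N else 0%N.

(** The binary expansion is w followed by that of z. For z in (0, 1] it is the one with infinitely
    many ones, in accordance with the half-open intervals of the potential. *)
Definition cyl w z : R := ((wcode w)%:R + z) / 2 ^+ wlen w.

Lemma wlen_cons n w : wlen (n :: w) = (n.+1 + wlen w)%N.
Proof. by rewrite /wlen big_cons. Qed.

Lemma wwt_cons n w : wwt (n :: w) = (2 ^ n.+1 - 1 + wwt w)%N.
Proof. by rewrite /wwt big_cons. Qed.

Lemma wlen_cat v w : wlen (v ++ w) = (wlen v + wlen w)%N.
Proof. by rewrite /wlen big_cat. Qed.

Lemma wwt_cat v w : wwt (v ++ w) = (wwt v + wwt w)%N.
Proof. by rewrite /wwt big_cat. Qed.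

Lemma wlen_nil : wlen [::] = 0%N. Proof. by rewrite /wlen big_nil. Qed.
Lemma wwt_nil : wwt [::] = 0%N. Proof. by rewrite /wwt big_nil. Qed.

Lemma size_le_wlen w : (size w <= wlen w)%N.
Proof. elim: w => //= n w IH; rewrite wlen_cons; lia. Qed.

Lemma wlen_le_wwt w : (wlen w <= wwt w)%N.
Proof.
elim: w => [|n w IH]; first by rewrite wlen_nil wwt_nil.
rewrite wlen_cons wwt_cons leq_add//.
by have := ltn_expl n.+1 (ltnSn 1); lia.
Qed.

Lemma cyl_nil z : cyl [::] z = z.
Proof. by rewrite /cyl /= wlen_nil add0r expr0 divr1. Qed.

Lemma cyl_cons n w z : cyl (n :: w) z = (1 + cyl w z) / 2 ^+ n.+1.
Proof.
rewrite /cyl /= wlen_cons natrD natrX exprD.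
by field; rewrite !expf_neq0.
Qed.

Lemma cyl_cat v w z : cyl (v ++ w) z = cyl v (cyl w z).
Proof. by elim: v => [|n v IH] /=; rewrite ?cyl_nil// !cyl_cons IH. Qed.

Lemma cyl_affine w z z' : cyl w z - cyl w z' = (z - z') / 2 ^+ wlen w.
Proof. by rewrite /cyl -mulrBl; congr (_ / _); ring. Qed.

Lemma wcode_lt w : (wcode w < 2 ^ wlen w)%N.
Proof.
elim: w => [|n w IH] /=; first by rewrite wlen_nil.
rewrite wlen_cons addSn expnS expnD mul2n -addnn.
have := expn_gt0 2 n; move: (2 ^ n)%N (2 ^ wlen w)%N IH => a b; nia.
Qed.

(** Leading zeros are invisible to [wcode], hence the condition on lengths. *)
Lemma wcode_inj v w : wlen v = wlen w -> wcode v = wcode w -> v = w.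
Proof.
elim: v w => [|n v IH] [|m w] //=; rewrite ?wlen_nil ?wlen_cons//.
move=> h1 h2; have := wcode_lt v; have := wcode_lt w => hw hv.
have e : wlen v = wlen w.
  case: (ltngtP (wlen v) (wlen w)) => // h.
  - have : (2 ^ (wlen v).+1 <= 2 ^ wlen w)%N by rewrite leq_exp2l.
    by move: h2; rewrite expnS; lia.
  - have : (2 ^ (wlen w).+1 <= 2 ^ wlen v)%N by rewrite leq_exp2l.
    by move: h2; rewrite expnS; lia.
by congr (_ :: _); [lia|apply: IH => //; move: h2; rewrite e; lia].
Qed.

Lemma cyl_itv w z : 0 < z <= 1 -> 0 < cyl w z <= 1.
Proof.
move=> /andP[z0 z1]; rewrite /cyl divr_gt0 ?exprn_gt0//=; last exact: ltr_wpDl.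
rewrite ler_pdivrMr ?exprn_gt0// mul1r -natrX.
have : (wcode w).+1%:R <= (2 ^ wlen w)%:R :> R by rewrite ler_nat wcode_lt.
by rewrite -natr1; lra.
Qed.

Lemma saint_petersburg_ge0 x : 0 <= saint_petersburg x.
Proof.
by rewrite /saint_petersburg; case: xgetP => // y -> [n [_ ->]]; rewrite exprn_ge0.
Qed.

Lemma birkhoff_sumD m n x :
  birkhoff_sum (m + n) x = birkhoff_sum m x + birkhoff_sum n (iter m doubling_map x).
Proof.
rewrite /birkhoff_sum big_split_ord /=; congr (_ + _).
by apply: eq_bigr => i _; rewrite addnC iterD.
Qed.

Lemma birkhoff_sum_mono m n x : (m <= n)%N -> birkhoff_sum m x <= birkhoff_sum n x.
Proof.
move=> /subnKC <-; rewrite birkhoff_sumD lerDl /birkhoff_sum sumr_ge0// => i _.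
exact: saint_petersburg_ge0.
Qed.

(** Doubling removes the leading zeros one at a time, the potential running through 2^n, ..., 2,
    1. *)
Lemma doubling_map_block n z : 0 < z <= 1 ->
  iter n.+1 doubling_map ((1 + z) / 2 ^+ n.+1) = z /\
  birkhoff_sum n.+1 ((1 + z) / 2 ^+ n.+1) = 2 ^+ n.+1 - 1.
Proof.
move=> /andP[z0 z1].
have itv m : 2 ^- m.+1 < (1 + z) / 2 ^+ m.+1 <= 2 ^- m.
  rewrite -[X in X < _]mul1r ltr_pM2r ?invr_gt0 ?exprn_gt0// ltrDl z0/=.
  rewrite -[leRHS](_ : 2 / 2 ^+ m.+1 = _); last by rewrite exprS; field; rewrite expf_neq0.
  by rewrite ler_pM2r ?invr_gt0 ?exprn_gt0//; lra.
have phi m : saint_petersburg ((1 + z) / 2 ^+ m.+1) = 2 ^+ m.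
  by apply: saint_petersburgE; exact: itv.
have b1 x : birkhoff_sum 1 x = saint_petersburg x.
  by rewrite /birkhoff_sum big_ord1.
elim: n => [|n [IH1 IH2]].
  split; last by rewrite b1 phi expr0 expr1; ring.
  rewrite /= /doubling_map expr1 mulrC divfK ?pnatr_eq0//.
  rewrite (@ceil_def _ _ 2); first by ring.
  by rewrite -[2]/(1 + 1)%R intrB intrD; lra.
have T1 : doubling_map ((1 + z) / 2 ^+ n.+2) = (1 + z) / 2 ^+ n.+1.
  have e : 2 * ((1 + z) / 2 ^+ n.+2) = (1 + z) / 2 ^+ n.+1.
    by rewrite exprS; field; rewrite expf_neq0.
  rewrite /doubling_map e (@ceil_def _ _ 1); first by ring.
  have /andP[h1 h2] := itv n; rewrite subrr (lt_trans _ h1) ?invr_gt0 ?exprn_gt0//=.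
  by apply: le_trans h2 _; rewrite invf_le1 ?exprn_gt0// exprn_ege1// ler1n.
split; first by rewrite iterSr T1.
rewrite -[n.+2]add1n birkhoff_sumD b1 /= T1 IH2 phi [2 ^+ (1 + n.+1)]exprS; ring.
Qed.

Lemma doubling_map_cyl w z : 0 < z <= 1 ->
  iter (wlen w) doubling_map (cyl w z) = z /\
  birkhoff_sum (wlen w) (cyl w z) = (wwt w)%:R.
Proof.
move=> z01; elim: w => [|n w [IH1 IH2]].
  by rewrite wlen_nil wwt_nil cyl_nil /birkhoff_sum big_ord0.
have [h1 h2] := doubling_map_block n (cyl_itv w z01).
rewrite cyl_cons wlen_cons birkhoff_sumD h2 h1 IH2 wwt_cons natrD natrB ?expn_gt0// natrX.
by split=> //; rewrite addnC iterD h1 IH1.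
Qed.

Lemma block_exists x : 0 < x <= 1 -> exists n z, 0 < z <= 1 /\ x = (1 + z) / 2 ^+ n.+1.
Proof.
move=> /andP[x0 x1].
have ex : exists n, 2 ^- n.+1 < x.
  have := @cvg_geometric R 1 2^-1.
  rewrite ger0_norm ?invr_ge0// invf_lt1// ltr1n => /(_ isT)/cvgrPdist_lt/(_ _ x0)[n _ /(_ n (leqnn n))].
  rewrite /= sub0r normrN mul1r => h; exists n; rewrite -exprVn.
  by apply: le_lt_trans (le_lt_trans (ler_norm _) h); rewrite exprS ler_piMl ?exprn_ge0// invf_le1// ler1n.
pose n := ex_minn ex; have hn : 2 ^- n.+1 < x <= 2 ^- n.
  rewrite /n; case: ex_minnP => -[|m] hm hmin; first by rewrite hm expr0 invr1.
  rewrite hm/= leNgt; apply/negP => /hmin; rewrite ltnn//.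
have p0 : 0 < (2:R) ^+ n.+1 by rewrite exprn_gt0.
exists n, (x * 2 ^+ n.+1 - 1); split; last by field; rewrite expf_neq0.
move: hn => /andP[h1 h2]; rewrite subr_gt0 -ltr_pdivrMr// mul1r h1/=.
rewrite lerBlDr -ler_pdivlMr//; apply: le_trans h2 _.
by rewrite exprS; apply: le_of_eq; field; rewrite expf_neq0.
Qed.

Lemma word_exists m x : 0 < x <= 1 ->
  exists w z, [/\ size w = m, 0 < z <= 1 & x = cyl w z].
Proof.
elim: m x => [|m IH] x x01; first by exists [::], x; rewrite cyl_nil.
have [n [y [y01 ->]]] := block_exists x01.
have [w [z [<- z01 ->]]] := IH y y01.
by exists (n :: w), z; rewrite cyl_cons.
Qed.

Fixpoint words J m : seq (seq nat) :=
  if m is m'.+1 then [seq n :: v | n <- iota 0 J, v <- words J m'] else [:: [::]].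

Lemma mem_words J m w : (w \in words J m) = (size w == m) && all (fun n => n < J)%N w.
Proof.
elim: m w => [|m IH] [|n w] //=.
- by apply/negP => /allpairsP[[a b] [_ _]].
- rewrite eqSS; apply/allpairsP/idP => [[[a b] /= [ha hb [-> ->]]]|/and3P[h1 h2 h3]].
  + by move: ha hb; rewrite mem_iota IH /= => -> /andP[-> ->].
  + by exists (n, w); rewrite mem_iota IH h1 h2 h3.
Qed.

Lemma words_uniq J m : uniq (words J m).
Proof.
elim: m => //= m IH; apply: allpairs_uniq => //; first exact: iota_uniq.
by move=> [a b] [a' b'] _ _ /= [-> ->].
Qed.

Definition weight (t q : R) w : R := \prod_(n <- w) bterm t q n.

Lemma weight_ge0 t q w : 0 <= weight t q w.
Proof. by rewrite /weight prodr_ge0// => n _; exact: bterm_ge0. Qed.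

Lemma weightE t q w : weight t q w = 2 `^ (- (t * (wlen w)%:R + q * (wwt w)%:R)).
Proof.
elim: w => [|n w IH].
  by rewrite /weight big_nil wlen_nil wwt_nil !mulr0 addr0 oppr0 powRr0.
rewrite /weight big_cons -/(weight t q w) IH wlen_cons wwt_cons btermE !pow2E -expRD; congr expR.
by rewrite !natrD natrB ?expn_gt0// natrX /len /wt; ring.
Qed.

Lemma sum_words t q J m : \sum_(w <- words J m) weight t q w = series (bterm t q) J ^+ m.
Proof.
elim: m => [|m IH] /=; first by rewrite big_seq1 /weight big_nil.
rewrite big_allpairs_dep/= exprS -IH [in RHS]/series /= /index_iota subn0 mulr_suml.
apply: eq_bigr => n _; rewrite mulr_sumr; apply: eq_bigr => w _.
by rewrite /weight big_cons.
Qed.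

End Words.

(** * Upper bound by covers with cylinders *)

Section UpperBound.
Context {R : realType}.
Implicit Types (v w : seq nat) (x z t q s : R) (n : nat).

Lemma ler_sum_subset (T : eqType) (us vs : seq T) (F : T -> R) : uniq us ->
  {subset us <= vs} -> (forall i, 0 <= F i) ->
  \sum_(i <- us) F i <= \sum_(i <- vs) F i.
Proof.
move=> + + F0; elim: us vs => [|a us IH] vs /=.
  by rewrite big_nil sumr_ge0.
move=> /andP[aus uus] sub; have avs : a \in vs by apply: sub; rewrite mem_head.
rewrite big_cons [leRHS](big_rem a)//= lerD2l IH// => b bus.
have : b \in a :: rem a vs by rewrite -(perm_mem (perm_to_rem avs)) sub// inE bus orbT.
by rewrite inE => /predU1P[ba|//]; move: aus; rewrite -ba bus.
Qed.

(** A finite family lies in finitely many of the lists [words J m] with m >= M, whose masses are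
    dominated by a geometric series. *)
Lemma sum_long_words t q M (ws : seq (seq nat)) : 0 < q -> pressure t q < 1 ->
  uniq ws -> (forall w, w \in ws -> (M <= size w)%N) ->
  \sum_(w <- ws) weight t q w <= pressure t q ^+ M / (1 - pressure t q).
Proof.
move=> q0 P1 uws wsM; set P := pressure t q in P1 *.
have P0 : 0 <= P by apply/ltW/pressure_gt0.
pose J := (\max_(w <- ws) \max_(n <- w) n).+1.
pose K := (\max_(w <- ws) size w).+1.
apply: (@le_trans _ _ (\sum_(w <- flatten [seq words J m | m <- iota M K]) weight t q w)).
  apply: ler_sum_subset => // [w wws|w]; last exact: weight_ge0.
  apply/flattenP; exists (words J (size w)).
    apply/mapP; exists (size w) => //; rewrite mem_iota wsM//= (@leq_trans K) ?leq_addl//.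
    by rewrite ltnS; exact: (leq_bigmax_seq (F := size) w wws isT).
  rewrite mem_words eqxx/=; apply/allP => n nw; rewrite ltnS.
  apply: leq_trans (leq_bigmax_seq (F := fun w : seq nat => (\max_(n <- w) n)%N) w wws isT).
  exact: (leq_bigmax_seq (F := id) n nw isT).
rewrite big_flatten big_map.
apply: (@le_trans _ _ (\sum_(m <- iota M K) P ^+ m)).
  apply: ler_sum => m _; rewrite sum_words lerXn2r ?nnegrE//.
    by rewrite /series /= sumr_ge0// => i _; exact: bterm_ge0.
  exact: pressure_ge_series.
have /(sums_ge K) : sums (fun n => P ^+ n) (1 - P)^-1 by apply: sums_geo; rewrite P0.
move=> /(_ (fun i => exprn_ge0 i P0)) h.
apply: le_trans (ler_wpM2l (exprn_ge0 M P0) h).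
rewrite /series mulr_sumr /index_iota subn0 -[M in iota M]addn0 iotaDl big_map.
by apply: le_of_eq; apply: eq_bigr => i _; rewrite exprD.
Qed.

Definition cylset w : set R := [set cyl w z | z in [set z | 0 < z <= 1]].

Lemma diam_cylset w : (diam (cylset w) <= (2^-1 ^+ wlen w)%:E)%E.
Proof.
apply: ge_ereal_sup => _ [->|[[x y] [/= [a /andP[a0 a1] <-] [b /andP[b0 b1] <-]] <-]].
  by rewrite lee_fin exprn_ge0.
rewrite lee_fin /= cyl_affine normrM normfV normrX (ger0_norm (ler0n _ 2)) exprVn.
by rewrite ler_piMl ?invr_ge0 ?exprn_ge0// ler_norml; apply/andP; split; lra.
Qed.

Lemma diam_ge0 (A : set R) : (0 <= diam A)%E.
Proof. by apply: ereal_sup_ubound; left. Qed.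

Lemma diam_set0 : diam (set0 : set R) = 0%E.
Proof.
apply/eqP; rewrite eq_le diam_ge0 andbT.
by apply: ge_ereal_sup => _ [->//|[[x y] [/= []]]].
Qed.

Lemma hausdorff_weight_ge0 s (A : set R) : (0 <= hausdorff_weight s A)%E.
Proof. by rewrite /hausdorff_weight; case: ifP => // _; exact: poweR_ge0. Qed.

Lemma hausdorff_premeasure_ge0 s delta (A : set R) : (0 <= hausdorff_premeasure s delta A)%E.
Proof.
apply: le_ereal_inf_tmp => _ [U _ <-]; apply: nneseries_ge0 => n _ _.
exact: hausdorff_weight_ge0.
Qed.

Lemma hausdorff_measure_ge0 s (A : set R) : (0 <= hausdorff_measure s A)%E.
Proof.
apply: (le_trans (hausdorff_premeasure_ge0 s 1 A)).
by apply: ereal_sup_ubound; exists 1 => //=.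
Qed.

Lemma hausdorff_weight_cylset s w : 0 <= s ->
  (hausdorff_weight s (cylset w) <= (2 `^ (- (s * (wlen w)%:R)))%:E)%E.
Proof.
move=> s0; rewrite /hausdorff_weight; case: ifP => _; first by rewrite lee_fin powR_ge0.
apply: (@le_trans _ _ (poweR (2^-1 ^+ wlen w)%:E s)).
  apply: gt0_ler_poweR => //; rewrite ?in_itv/= ?diam_ge0 ?leey ?lee_fin ?exprn_ge0//.
  exact: diam_cylset.
rewrite poweR_EFin lee_fin exprVn -powR_mulrn// -powRN -powRrM.
by rewrite mulNr mulrC.
Qed.

Lemma hausdorff_measure_level_set (a q s : R) : 1 <= a -> 0 < q ->
  pressure_root q + q * a < s -> hausdorff_measure s (level_set a) = 0%E.
Proof.
move=> a1 q0 hs; apply/eqP; rewrite eq_le hausdorff_measure_ge0 andbT.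
apply: ge_ereal_sup => _ [delta /= d0 <-].
apply/lee_addgt0Pr => e e0; rewrite add0e.
(* Half of the slack goes into [eps]; the other half puts t above the root. *)
pose eps := (s - (pressure_root q + q * a)) / (2 * q).
have eps0 : 0 < eps by rewrite divr_gt0 ?subr_gt0// mulr_gt0.
pose t := s - q * (a + eps).
have rt : pressure_root q < t.
  rewrite /t /eps (_ : q * _ = q * a + (s - (pressure_root q + q * a)) / 2); last by field; rewrite gt_eqF.
  lra.
have s0 : 0 <= s.
  have := root_gtN q0; have : q * 1 <= q * a by rewrite ler_wpM2l// ltW.
  lra.
have P1 : pressure t q < 1 by rewrite pressure_lt1.
have P0 := pressure_gt0 t q0; set P := pressure t q in P0 P1.
have geoP c r : 0 <= r < 1 -> 0 < c -> \forall M \near \oo, r ^+ M <= c :> R.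
  move=> /andP[r0 r1] c0; have := @cvg_geometric R 1 r.
  rewrite ger0_norm// => /(_ r1)/cvgrPdist_le/(_ _ c0); apply: filterS => M /=.
  by rewrite sub0r normrN mul1r => /(le_trans (ler_norm _)).
have [M [hM1 hM2]] : exists M, P ^+ M <= e * (1 - P) /\ 2^-1 ^+ M <= delta.
  have h1 : 0 < e * (1 - P) by rewrite mulr_gt0// subr_gt0.
  have half : 0 <= (2^-1 : R) < 1 by rewrite invr_ge0 ler0n/= invf_lt1// ltr1n.
  have Pi : 0 <= P < 1 by rewrite ltW.
  have [M _ /(_ M (leqnn M)) h] := filterI (geoP _ _ Pi h1) (geoP _ _ half d0).
  by exists M.
pose good w := (M <= size w)%N && ((wwt w)%:R <= (a + eps) * (wlen w)%:R).
(* Words are enumerated by [pickle]; the other indices get the empty set, of weight 0. *)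
pose U i : set R := if pickle_inv i is Some w then if good w then cylset w else set0 else set0.
pose h i : R := if pickle_inv i is Some w then if good w then weight t q w else 0 else 0.
have hw0 : hausdorff_weight s (set0 : set R) = 0%E by rewrite /hausdorff_weight eqxx.
have hU i : (hausdorff_weight s (U i) <= (h i)%:E)%E.
  rewrite /U /h; case: pickle_inv => [w|]; last by rewrite hw0.
  case: ifP => [/andP[_ gw]|_]; last by rewrite hw0.
  apply: le_trans (hausdorff_weight_cylset _ s0) _.
  (* For a good word, s length = t length + q (a + eps) length >= t length + q weight. *)
  rewrite lee_fin weightE ler_powR ?ler1n// lerN2.
  have := ler_wpM2l (ltW q0) gw; rewrite /t; lra.
apply: (@le_trans _ _ (\sum_(0 <= i <oo) hausdorff_weight s (U i))%E).
  apply: ereal_inf_lbound; exists U => //; split.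
    move=> x [x01 cx].
    have aE : a < a + eps by rewrite ltrDl.
    have [N _ hN] : \forall n \near \oo, n%:R^-1 * birkhoff_sum n x <= a + eps.
      by have /cvgrPdist_le/(_ _ eps0) := cx; apply: filterS => n; rewrite ler_norml => /andP[]; lra.
    (* A word is at least as long as its number of letters, so at its end the average is already at
       most a + eps; [N.+1] makes the length positive. *)
    have [w [z [sw z01 xE]]] := word_exists (maxn M N.+1) x01.
    exists (pickle w) => //; rewrite /U pickleK_inv.
    have sL := size_le_wlen w.
    have L0 : (0 < wlen w)%N by apply: leq_trans sL; rewrite sw leq_max orbT.
    have -> : good w.
      rewrite /good sw leq_maxl/=; have /hN : (N <= wlen w)%N.
        by apply: leq_trans sL; rewrite sw leq_max leqnSn orbT.
      rewrite xE (doubling_map_cyl w z01).2 ler_pdivrMl ?ltr0n// mulrC//.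
    by exists z.
  move=> i; rewrite /U; case: pickle_inv => [w|]; last by rewrite diam_set0 lee_fin ltW.
  case: ifP => [/andP[gw _]|_]; last by rewrite diam_set0 lee_fin ltW.
  apply: le_trans (diam_cylset w) _; rewrite lee_fin; apply: le_trans hM2.
  by rewrite ler_wiXn2l ?invr_ge0// ?invf_le1 ?ler1n// (leq_trans gw)// size_le_wlen.
apply: lime_le; first by apply: is_cvg_nneseries => n _ _; exact: hausdorff_weight_ge0.
apply: nearW => N; apply: (@le_trans _ _ (\sum_(0 <= i < N) (h i)%:E)%E).
  by apply: lee_sum => i _; exact: hU.
rewrite sumEFin lee_fin.
have -> : \sum_(0 <= i < N) h i = \sum_(w <- [seq w <- pmap pickle_inv (index_iota 0 N) | good w]) weight t q w.
  rewrite big_filter [RHS]big_mkcond big_pmap; apply: eq_bigr => i _.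
  by rewrite /h; case: pickle_inv => //= w.
apply: le_trans (sum_long_words (M := M) q0 P1 _ _) _.
- by rewrite filter_uniq// (pmap_uniq (@pickle_invK _))// iota_uniq.
- by move=> w; rewrite mem_filter /good => /andP[/andP[-> _] _].
- by rewrite ler_pdivrMr ?subr_gt0.
Qed.

Lemma hausdorff_dim_level_set_le (a q : R) : 1 <= a -> 0 < q ->
  (hausdorff_dim (level_set a) <= (pressure_root q + q * a)%:E)%E.
Proof.
move=> a1 q0; apply/lee_addgt0Pr => e e0; rewrite -EFinD.
apply: ereal_inf_lbound; exists (pressure_root q + q * a + e) => //; split.
  have := root_gtN q0; have : q * 1 <= q * a by rewrite ler_wpM2l// ltW.
  by rewrite /=; lra.
by apply: (hausdorff_measure_level_set a1 q0); rewrite ltrDl.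
Qed.

End UpperBound.

(** * Lower bound *)

Section Tilting.
Context {R : realType}.
Implicit Types (v w u : seq nat) (a c t q : R) (n : nat).
Local Notation root := (@pressure_root R).

Lemma drift_near a q0 (e : R) : 0 < q0 -> 0 < e -> exists2 d, 0 < d <= q0 / 2 &
  forall q, `|q - q0| <= d -> `|drift a (root q) q - drift a (root q0) q0| < e.
Proof.
move=> q00 e0; have q20 : 0 < q0 / 2 by rewrite divr_gt0.
have [C C0 HC] := root_moment_lip (2 * q0) q20 (expgrowth_drift a).
exists (Num.min (q0 / 2) (e / (C + 1))).
  by rewrite lt_min q20 divr_gt0 ?ltr_wpDl//= ge_min lexx.
move=> q; rewrite le_min => /andP[h1 h2].
apply: le_lt_trans (HC q q0 _ _) _.
- by move: h1; rewrite ler_norml => /andP[]; lra.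
- by lra.
have C1 : 0 < C + 1 by rewrite ltr_wpDl.
have : (C + 1) * `|q - q0| <= e by rewrite mulrC -ler_pdivlMr.
have [->|qq] := eqVneq q q0; first by rewrite subrr normr0 !mulr0.
have : 0 < `|q - q0| by rewrite normr_gt0 subr_eq0.
nra.
Qed.

Lemma drift_affine a b t q : 0 < q -> drift b t q = drift a t q + (a - b) * moment (@len R) t q.
Proof. by move=> q0; rewrite !driftE//; ring. Qed.

(** Moving along the line of slope a multiplies the mass by 2^((q0 - q1)(weight - a length)), which
    is at least 1 on words of large ratio. *)
Lemma weight_tilt_up a t0 q0 t1 q1 w : q1 <= q0 -> t1 = t0 + (q0 - q1) * a ->
  a * (wlen w)%:R <= (wwt w)%:R -> weight t0 q0 w <= weight t1 q1 w.
Proof.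
move=> q10 -> h; rewrite !weightE ler_powR ?ler1n// lerN2.
have : 0 <= q0 - q1 by rewrite subr_ge0.
move=> /ler_wpM2l/(_ _ _ h); lra.
Qed.

Lemma weight_tilt_down a t0 q0 t2 q2 w : q0 <= q2 -> t2 = t0 - (q2 - q0) * a ->
  (wwt w)%:R <= a * (wlen w)%:R -> weight t0 q0 w <= weight t2 q2 w.
Proof.
move=> q10 -> h; rewrite !weightE ler_powR ?ler1n// lerN2.
have : 0 <= q2 - q0 by rewrite subr_ge0.
move=> /ler_wpM2l/(_ _ _ h); lra.
Qed.

Lemma root_lt_tilt a q q' : 0 < q -> 0 < q' -> (q' - q) * drift a (root q) q < 0 ->
  root q < root q' + (q' - q) * a.
Proof.
move=> q0 q'0 h; have := tangent_drift a q0 q'0.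
have M1 := moment_len_ge1 q0 (pressure_root1 q0); have M0 := lt_le_trans ltr01 M1.
rewrite addrC -lerBlDl sub0r => h1.
have : 0 < (root q' + q' * a - (root q + q * a)) * moment (@len R) (root q) q.
  by apply: lt_le_trans h1; rewrite oppr_gt0.
rewrite pmulr_lgt0// -[in X in _ -> X]subr_gt0.
by rewrite (_ : _ - root q = root q' + q' * a - (root q + q * a))//; ring.
Qed.

(* At a critical parameter q0 for a slope slightly below a, moving q down along
   the line of slope a, or up along the line of slope a2 < a, makes the pressure
   drop below 1. *)
Lemma exists_tilts a c : 1 < a -> c < legendre a -> exists t0 q0 t1 q1 t2 q2 a2 : R,
  [/\ 0 < q0 /\ pressure t0 q0 = 1, 0 < q1 <= q0 /\ q0 <= q2, t1 = t0 + (q0 - q1) * a /\ pressure t1 q1 < 1,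
      t2 = t0 - (q2 - q0) * a2 /\ pressure t2 q2 < 1 & c < t0 + q0 * a2].
Proof.
move=> a1 ca.
have am0 : 0 < a - 1 by rewrite subr_gt0.
have cd0 : 0 < legendre a - c by rewrite subr_gt0.
(* The critical slope a - eta lies strictly between a2 = a - 2 eta and a, so the drifts for a and a2
   have opposite signs. The second bound keeps the loss 2 q0 eta below [legendre a - c]. *)
pose eta := Num.min ((a - 1) / 2) ((legendre a - c) * (a - 1) / 8).
have eta0 : 0 < eta by rewrite lt_min !divr_gt0// mulr_gt0.
have eta1 : eta <= (a - 1) / 2 by rewrite ge_min lexx.
have eta2 : eta <= (legendre a - c) * (a - 1) / 8 by rewrite ge_min lexx orbT.
pose a' := a - eta; have a'1 : 1 < a' by rewrite /a'; lra.
have [q0 q00 D0] := critical_point a'1.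
pose t0 := root q0; have P0 : pressure t0 q0 = 1 by exact: pressure_root1.
(* Since q0 depends on eta, a bound independent of eta is required: [legendre_le1] and [root_gtN]
   give q0 (a' - 1) < 1. *)
have q0le : q0 * (a - 1) <= 2.
  have := legendre_le1 (ltW a'1); rewrite (legendre_critical (ltW a'1) q00 D0).
  have := root_gtN q00; have : q0 * eta <= q0 * ((a - 1) / 2) by rewrite ler_wpM2l// ltW.
  rewrite /a'; lra.
have L0 : 0 < moment (@len R) t0 q0 := lt_le_trans ltr01 (moment_len_ge1 q00 P0).
pose a2 := a - 2 * eta.
have Da : drift a t0 q0 < 0.
  by rewrite (drift_affine a' _ _ q00) D0 add0r pmulr_llt0// /a'; lra.
have Da2 : 0 < drift a2 t0 q0.
  by rewrite (drift_affine a' _ _ q00) D0 add0r pmulr_lgt0// /a' /a2; lra.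
(* [root_lt_tilt] uses the sign of the drift at the new parameters q1 and q2; continuity carries it
   over from q0. *)
have [|d1 /andP[d10 d1q] H1] := @drift_near a q0 (- drift a t0 q0) q00; first by rewrite oppr_gt0.
have [d2 /andP[d20 d2q] H2] := @drift_near a2 q0 (drift a2 t0 q0) q00 Da2.
pose q1 := q0 - d1; pose q2 := q0 + d2.
have q10 : 0 < q1 by rewrite /q1; lra.
have q20 : 0 < q2 by rewrite /q2; lra.
have D1 : drift a (root q1) q1 < 0.
  have := H1 q1; rewrite /q1 addrAC subrr add0r normrN gtr0_norm// lexx => /(_ isT).
  by rewrite ltr_norml => /andP[_]; rewrite ltrBlDr addNr.
have D2 : 0 < drift a2 (root q2) q2.
  have := H2 q2; rewrite /q2 addrAC subrr add0r gtr0_norm// lexx => /(_ isT).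
  by rewrite ltr_norml => /andP[+ _]; rewrite ltrBrDr addNr.
have q01 : q0 - q1 = d1 by rewrite /q1 subKr.
have q02 : q0 - q2 = - d2 by rewrite /q2 opprD addNKr.
exists t0, q0, (t0 + (q0 - q1) * a), q1, (t0 - (q2 - q0) * a2), q2, a2; split.
- by [].
- by rewrite q10/= /q1 /q2 gerBl lerDl !ltW.
- by split=> //; rewrite pressure_lt1// root_lt_tilt// q01 pmulr_rlt0.
- split=> //; rewrite pressure_lt1// -mulNr opprB root_lt_tilt//.
  by rewrite q02 mulNr oppr_lt0 mulr_gt0.
- have := legendre_le (ltW a1) q00; rewrite -/t0 /a2.
  have : q0 * eta <= q0 * ((legendre a - c) * (a - 1) / 8) by rewrite ler_wpM2l// ltW.
  have := ler_wpM2l (ltW cd0) q0le; move: cd0; lra.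
Qed.

Lemma exp_beats_square (C r : R) : 0 <= C -> 0 < r ->
  \forall n \near \oo, C * n%:R ^+ 2 < 2 `^ (r * n%:R).
Proof.
move=> C0 r0; pose b := r * ln 2 / 3; have b0 : 0 < b by rewrite divr_gt0// mulr_gt0// ln2_gt0.
have b30 : 0 < b ^+ 3 by rewrite exprn_gt0.
pose N := (Num.truncn (C / b ^+ 3)).+1.
have hN : C / b ^+ 3 < N%:R.
  by have /andP[] := truncn_itv (divr_ge0 C0 (ltW b30)).
exists N => // n /= Nn.
have n0 : 0 < n%:R :> R by rewrite ltr0n (leq_trans _ Nn).
apply: (@lt_le_trans _ _ ((b * n%:R) ^+ 3)).
  rewrite exprMn [n%:R ^+ 3]exprS mulrA ltr_pM2r ?exprn_gt0// -ltr_pdivrMl// mulrC.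
  by apply: lt_le_trans hN _; rewrite ler_nat.
rewrite pow2E (_ : r * n%:R * ln 2 = 3%:R * (b * n%:R)); last by rewrite /b; field.
rewrite expRM_natl.
have h : b * n%:R <= expR (b * n%:R) by apply: (le_trans _ (expR_ge1Dx _)); rewrite lerDr.
by apply: lerXn2r => //; rewrite nnegrE ?expR_ge0// mulr_ge0// ltW.
Qed.

End Tilting.

(** * Many words of common length and weight *)

Section Pigeonhole.
Context {R : realType}.
Implicit Types (v w u : seq nat) (a c t q : R) (n : nat).

Lemma words_bounds J n u : u \in words J n -> [/\ (n <= wlen u)%N, (wlen u <= n * J)%N & (wwt u <= n * 2 ^ J)%N].
Proof.
rewrite mem_words => /andP[/eqP <- uJ]; split; first exact: size_le_wlen.
- elim: u uJ => [|x u IH] /=; first by rewrite wlen_nil.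
  by move=> /andP[xJ /IH]; rewrite wlen_cons mulSn; lia.
- elim: u uJ => [|x u IH] /=; first by rewrite wwt_nil.
  move=> /andP[xJ /IH]; rewrite wwt_cons mulSn.
  have : (2 ^ x.+1 <= 2 ^ J)%N by rewrite leq_exp2l.
  by lia.
Qed.

(* Chernoff bound: among the words of n letters, those with weight outside
   [a2 * length, a * length] have exponentially small total mass at (t0, q0),
   because on them a tilted mass of total < 1 is larger. Of the remaining words,
   which fall into polynomially many classes of given length and weight, one
   class must have many elements. *)
Lemma many_words a c : 1 < a -> c < legendre a -> exists (D : seq (seq nat)) (l w : nat),
  [/\ uniq D, (0 < l)%N, {in D, forall u, wlen u = l /\ wwt u = w},
      w%:R <= a * l%:R & 2 `^ (c * l%:R) <= (size D)%:R].
Proof.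
move=> a1 ca; have [t0 [q0 [t1 [q1 [t2 [q2 [a2 H]]]]]]] := exists_tilts a1 ca.
have {H} [[q00 P0] [/andP[q10 q1q0] q0q2] [t1E P1] [t2E P2] ca2] := H.
have q20 : 0 < q2 := lt_le_trans q00 q0q2.
(* As c + 2 k = t0 + q0 a2, a good word of length i has mass at most 2^(-(c + 2 k) i). *)
pose k := (t0 + q0 * a2 - c) / 2; have k0 : 0 < k by rewrite divr_gt0// subr_gt0.
pose rho := Num.max (pressure t1 q1) (pressure t2 q2).
have rho0 : 0 < rho by rewrite lt_max pressure_gt0.
have rho1 : rho < 1 by rewrite gt_max P1 P2.
(* Truncating the alphabet loses mass; above this threshold the total S^n still dominates rho^n and
   is at least 2^(-k n). *)
pose th := Num.max ((1 + rho) / 2) (2 `^ (- k)).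
have th1 : th < 1 by rewrite gt_max pow2_lt1 ?oppr_lt0// andbT; lra.
have hP := pressure_sums t0 q00; rewrite P0 in hP.
have [J hJ] : exists J, th < series (bterm t0 q0) J.
  have [/cvgr_gt/(_ _ th1)[J _ /(_ J (leqnn J)) h]] := hP.
  by exists J.
set S := series _ _ in hJ.
have S1 : S <= 1 by apply: sums_ge hP => i; exact: bterm_ge0.
have rS : rho < S by apply: le_lt_trans hJ; rewrite le_max; apply/orP; left; lra.
have kS : 2 `^ (- k) <= S by apply: le_trans (ltW hJ); rewrite le_max lexx orbT.
have S0 : 0 < S := lt_trans rho0 rS.
have near1 : \forall n \near \oo, 4 * rho ^+ n <= S ^+ n.
  have := @cvg_geometric R 1 (rho / S).
  have rS0 : 0 <= rho / S by rewrite divr_ge0// ltW.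
  have q4 : 0 < 4^-1 :> R by rewrite invr_gt0.
  rewrite ger0_norm// ltr_pdivrMr// mul1r => /(_ rS)/cvgrPdist_le/(_ _ q4).
  apply: filterS => n; rewrite /= sub0r normrN mul1r => /(le_trans (ler_norm _)).
  by rewrite expr_div_n ler_pdivrMr ?exprn_gt0// mulrC ler_pdivlMr// mulrC.
have near2 := exp_beats_square (ler0n R (2 * (J.+1 * (2 ^ J).+1))%N) k0.
have [n [h1 [h2 n0]]] : exists n, 4 * rho ^+ n <= S ^+ n /\
   (2 * (J.+1 * (2 ^ J).+1))%N%:R * n%:R ^+ 2 < 2 `^ (k * n%:R) :> R /\ (0 < n)%N.
  have [n _ /(_ n (leqnn n)) [h1 [h2 h3]]] := filterI near1 (filterI near2 (nbhs_infty_gt 0)).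
  by exists n.
pose A := (n * J)%N; pose B := (n * 2 ^ J)%N.
have AB : (2 * (A.+1 * B.+1)%N%:R : R) < 2 `^ (k * n%:R).
  apply: le_lt_trans h2; rewrite -natrX -!natrM ler_nat /A /B.
  have le1 i : ((n * i).+1 <= n * i.+1)%N by rewrite mulnS -addn1 addnC leq_add2r.
  rewrite -mulnA leq_mul2l/=; apply: leq_trans (leq_mul (le1 J) (le1 (2 ^ J)%N)) _.
  by rewrite mulnACA -mulnn mulnC.
pose good u := (a2 * (wlen u)%:R <= (wwt u)%:R) && ((wwt u)%:R <= a * (wlen u)%:R).
(* If every class were small, good words would have mass below S^n / 2, bad ones have at most 2
   rho^n <= S^n / 2, and the total could not be S^n. *)
apply: contrapT => Hno.
have class i j : \sum_(u <- words J n | good u && ((inord (wlen u) == i :> 'I_A.+1) && (inord (wwt u) == j :> 'I_B.+1)))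
     weight t0 q0 u <= 2 `^ (- (2 * k * n%:R)).
  rewrite -big_filter; set D := seq.filter _ _.
  have hD u : u \in D -> [/\ good u, wlen u = i, wwt u = j & (n <= i)%N].
    rewrite mem_filter => /andP[/andP[gu /andP[/eqP ui /eqP uj]] /words_bounds[b1 b2 b3]].
    have ui' : wlen u = i by rewrite -ui inordK// ltnS.
    by split; rewrite // -?ui'// -uj inordK// ltnS.
  have [D0|[u0 u0D]] : D = [::] \/ exists u, u \in D.
    by case: D {hD} => [|u D]; [left|right; exists u; rewrite mem_head].
    by rewrite D0 big_nil powR_ge0.
  have [gu ui uj ni] := hD _ u0D.
  have sD : (size D)%:R < 2 `^ (c * i%:R) :> R.
    rewrite ltNge; apply/negP => sD; apply: Hno; exists D, i, j; split => //.
    - by rewrite filter_uniq// words_uniq.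
    - exact: leq_trans ni.
    - by move=> u /hD[].
    - by move: gu; rewrite /good ui uj => /andP[].
  apply: (@le_trans _ _ (\sum_(u <- D) 2 `^ (- ((c + 2 * k) * i%:R)))).
    rewrite big_seq [leRHS]big_seq; apply: ler_sum => u /hD[/andP[gu1 _] ui' _ _].
    rewrite weightE ler_powR ?ler1n// lerN2 ui'; rewrite ui' in gu1.
    have := ler_wpM2l (ltW q00) gu1.
    have -> : c + 2 * k = t0 + q0 * a2 by rewrite /k; field.
    by lra.
  rewrite big_const_seq count_predT iter_addr_0 -[_ *+ size D]mulr_natl.
  apply: (@le_trans _ _ (2 `^ (c * i%:R) * 2 `^ (- ((c + 2 * k) * i%:R)))).
    by rewrite ler_wpM2r ?powR_ge0// ltW.
  rewrite -powRD ?pnatr_eq0 ?implybT// ler_powR ?ler1n//.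
  have : k * n%:R <= k * i%:R by rewrite ler_wpM2l ?(ltW k0)// ler_nat.
  lra.
have good_sum : \sum_(u <- words J n | good u) weight t0 q0 u <= (A.+1 * B.+1)%N%:R * 2 `^ (- (2 * k * n%:R)).
  rewrite (partition_big (fun u => (inord (wlen u), inord (wwt u)) : 'I_A.+1 * 'I_B.+1) xpredT)//=.
  apply: (@le_trans _ _ (\sum_(p : 'I_A.+1 * 'I_B.+1) 2 `^ (- (2 * k * n%:R)))).
    by apply: ler_sum => -[i j] _; apply: le_trans (class i j); apply: le_of_eq; apply: eq_bigl.
  by rewrite sumr_const card_prod !card_ord -[_ *+ (_ * _)%N]mulr_natl.
have bad_sum : \sum_(u <- words J n | ~~ good u) weight t0 q0 u <= 2 * rho ^+ n.
  apply: (@le_trans _ _ (\sum_(u <- words J n | ~~ good u) (weight t1 q1 u + weight t2 q2 u))).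
    apply: ler_sum => u; rewrite /good negb_and -!ltNge => /orP[h|h].
    - apply: le_trans (weight_tilt_down q0q2 t2E (ltW h)) _.
      by rewrite lerDr weight_ge0.
    - apply: le_trans (weight_tilt_up q1q0 t1E (ltW h)) _.
      by rewrite lerDl weight_ge0.
  apply: (@le_trans _ _ (\sum_(u <- words J n) (weight t1 q1 u + weight t2 q2 u))).
    rewrite [leRHS](bigID good)/= lerDr sumr_ge0// => u _.
    by rewrite addr_ge0 ?weight_ge0.
  rewrite big_split/= !sum_words mulrDl mul1r.
  have sb t q : 0 < q -> pressure t q <= rho -> series (bterm t q) J ^+ n <= rho ^+ n.
    move=> qq tq; rewrite lerXn2r ?nnegrE ?(ltW rho0)//.
      by rewrite /series /= sumr_ge0// => i _; exact: bterm_ge0.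
    exact: le_trans (pressure_ge_series _ _ qq) tq.
  by rewrite lerD// sb// le_max lexx ?orbT.
have := sum_words t0 q0 J n; rewrite (bigID good)/= -/S => tot.
have kn : 2 `^ (- (k * n%:R)) <= S ^+ n.
  have -> : 2 `^ (- (k * n%:R)) = (2 `^ (- k)) ^+ n :> R.
    by rewrite -powR_mulrn ?powR_ge0// -powRrM mulNr.
  by rewrite lerXn2r ?nnegrE ?powR_ge0// ltW.
have : (A.+1 * B.+1)%N%:R * 2 `^ (- (2 * k * n%:R)) < 2 `^ (- (k * n%:R)) / 2 :> R.
  rewrite ltr_pdivlMr// mulrAC -[ltRHS]mul1r.
  rewrite (_ : - (k * n%:R) = k * n%:R + - (2 * k * n%:R)); last by ring.
  rewrite powRD ?pnatr_eq0 ?implybT// mul1r ltr_pM2r ?powR_gt0// mulrC//.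
by move: tot good_sum bad_sum h1 kn; lra.
Qed.

End Pigeonhole.

(** * Dimension bounds from maps with Hoelder inverse *)

Section Holder.
Context {R : realType}.
Implicit Types (A : set R) (f : R -> R) (s C x y : R).

Lemma le_dist_diam A x y : A x -> A y -> (`|x - y|%:E <= diam A)%E.
Proof. by move=> Ax Ay; apply: ereal_sup_ubound; right; exists (x, y). Qed.

(* The preimages of a cover of A by sets U_i cover [0, 1[ and lie in intervals
   of length 2 C (diam U_i)^s, so their total length is at least 1. *)
Lemma hausdorff_measure_holder f A s C : 0 <= s -> 0 <= C ->
  (forall y, 0 <= y < 1 -> A (f y)) ->
  (forall y y', 0 <= y < 1 -> 0 <= y' < 1 -> `|y - y'| <= C * `|f y - f y'| `^ s) ->
  hausdorff_measure s A != 0%E.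
Proof.
move=> s0 C0 fA H; apply/negP => /eqP hA.
have C2 : 0 < 2 * C + 1 by rewrite ltr_wpDl// mulr_ge0.
have : (hausdorff_premeasure s 1 A < ((2 * C + 1)^-1)%:E)%E.
  apply: (@le_lt_trans _ _ (hausdorff_measure s A)).
    by apply: ereal_sup_ubound; exists 1 => //=.
  by rewrite hA lte_fin invr_gt0.
move=> /ereal_inf_lt[_ [U [AU dU] <-]] hU.
have wfin i : hausdorff_weight s (U i) \is a fin_num.
  rewrite /hausdorff_weight; case: ifP => // _; apply: fin_num_poweR.
  rewrite fin_numE; have := diam_ge0 (U i); have := dU i.
  by case: (diam (U i)).
pose w i := fine (hausdorff_weight s (U i)).
have w0 i : 0 <= w i by rewrite fine_ge0// hausdorff_weight_ge0.
have center i : exists c, forall y, 0 <= y < 1 -> U i (f y) -> `|y - c| <= C * w i.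
  have [[c [c01 Uc]]|no] := pselect (exists c, 0 <= c < 1 /\ U i (f c)); last first.
    by exists 0 => y y01 Uy; exfalso; apply: no; exists y.
  exists c => y y01 Uy; apply: le_trans (H y c y01 c01) _.
  rewrite ler_wpM2l//.
  have Un0 : U i == set0 = false by apply/eqP => Ui; move: Uc; rewrite Ui.
  rewrite -lee_fin /w fineK// /hausdorff_weight Un0 -poweR_EFin.
  apply: gt0_ler_poweR => //; rewrite ?in_itv/= ?andbT ?lee_fin ?leey ?diam_ge0// ?normr_ge0//.
  exact: le_dist_diam.
have [c hc] := choice center.
pose I i : set R := `[c i - C * w i, c i + C * w i]%classic.
have cover : `[0%R, 1%R[%classic `<=` \bigcup_i I i.
  move=> y; rewrite /= in_itv/= => y01.
  have [i _ Ui] := AU _ (fA y y01); exists i => //.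
  by rewrite /I /= in_itv/= -ler_distlC distrC; exact: hc.
have : (lebesgue_measure (`[0%R, 1%R[%classic : set R) <=
        \sum_(0 <= i <oo) lebesgue_measure (I i))%E.
  by apply: measure_sigma_subadditive => // i; exact: measurable_itv.
rewrite lebesgue_measure_itv/= lte_fin ltr01 -EFinB subr0 leNgt => /negP; apply.
apply: (@le_lt_trans _ _ (\sum_(0 <= i <oo) (2 * C)%:E * hausdorff_weight s (U i))%E).
  apply: lee_nneseries => // i _; rewrite /I lebesgue_measure_itv/= lte_fin.
  rewrite -[hausdorff_weight _ _]fineK// -/(w i) -EFinM.
  case: ifP => _; last by rewrite lee_fin !mulr_ge0.
  by rewrite -EFinB lee_fin; apply: le_of_eq; ring.
rewrite nneseriesZl; last by move=> i _; exact: hausdorff_weight_ge0.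
have [C00|C0'] := eqVneq C 0; first by rewrite C00 mulr0 mul0e.
have C20 : 0 < 2 * C by rewrite mulr_gt0// lt_neqAle eq_sym C0'.
apply: (@lt_trans _ _ ((2 * C)%:E * ((2 * C + 1)^-1)%:E)%E).
  by rewrite lte_pmul2l.
by rewrite -EFinM lte_fin ltr_pdivrMr// mul1r ltrDl.
Qed.

(** Distances at most 1 allow the exponent s to be lowered to any u < s, to which
    [hausdorff_measure_holder] then applies. *)
Lemma hausdorff_dim_holder f A s C : 0 <= C ->
  (forall y, 0 <= y < 1 -> A (f y)) ->
  (forall y y', 0 <= y < 1 -> 0 <= y' < 1 -> `|f y - f y'| <= 1) ->
  (forall y y', 0 <= y < 1 -> 0 <= y' < 1 -> `|y - y'| <= C * `|f y - f y'| `^ s) ->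
  (s%:E <= hausdorff_dim A)%E.
Proof.
move=> C0 fA f1 H; apply: le_ereal_inf_tmp => _ [u /= [u0 hu] <-]; rewrite lee_fin leNgt.
apply/negP => us; move/eqP: hu; apply/negP.
apply: (hausdorff_measure_holder u0 C0 fA) => y y' y01 y01'.
apply: le_trans (H y y' y01 y01') _; rewrite ler_wpM2l//.
(* Separate because 0 to the power u is 1 when u = 0; the power s of 0 is 0, as s > u >= 0. *)
have [e|n0] := eqVneq (`|f y - f y'|) 0.
  by rewrite e powR0 ?powR_ge0// gt_eqF// (le_lt_trans u0).
by apply: ger_powR (ltW us); rewrite lt_neqAle eq_sym n0 normr_ge0 f1.
Qed.

End Holder.

(** * Moran sets of freely concatenated words *)

Section Moran.
Context {R : realType}.
Variables (a s K C : R) (lmax : nat) (D : nat -> seq (seq nat)) (l w : nat -> nat).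
Implicit Types (x y z : R) (u v : seq nat) (n i : nat).

Definition lsum n : nat := \sum_(i < n) l i.
Definition wsum n : nat := \sum_(i < n) w i.
Definition choices n : nat := \prod_(i < n) size (D i).

Hypotheses (s0 : 0 < s) (K0 : 0 < K).
Hypothesis D_uniq : forall i, uniq (D i).
Hypothesis D_lw : forall i, {in D i, forall u, wlen u = l i /\ wwt u = w i}.
Hypothesis l_bound : forall i, (0 < l i <= lmax)%N.
Hypothesis balanced : forall n, `|(wsum n)%:R - a * (lsum n)%:R| <= C.
Hypothesis many : forall n, K * 2 `^ (s * (lsum n)%:R) <= (choices n)%:R.

Let lsumS n : lsum n.+1 = (lsum n + l n)%N.
Proof. by rewrite /lsum big_ord_recr. Qed.

Let wsumS n : wsum n.+1 = (wsum n + w n)%N.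
Proof. by rewrite /wsum big_ord_recr. Qed.

Let choicesS n : choices n.+1 = (choices n * size (D n))%N.
Proof. by rewrite /choices big_ord_recr. Qed.

Let choices_gt0 n : (0 < choices n)%N.
Proof. by rewrite -(ltr_nat R) (lt_le_trans _ (many n))// mulr_gt0// powR_gt0. Qed.

Let size_gt0 i : (0 < size (D i))%N.
Proof. by have := choices_gt0 i.+1; rewrite choicesS muln_gt0 => /andP[]. Qed.

(* Mixed radix expansion of y in base size (D 0), size (D 1), ... *)
Fixpoint remainder y n : R := if n is n'.+1 then
    let x := (size (D n'))%:R * remainder y n' in x - (Num.truncn x)%:R else y.
Definition digit y n : nat := Num.truncn ((size (D n))%:R * remainder y n).
Definition letter y n := nth [::] (D n) (digit y n).
Fixpoint moran_prefix y n : seq nat := if n is n'.+1 then moran_prefix y n' ++ letter y n' else [::].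
Definition moran_point y : R := limn (fun n => cyl (moran_prefix y n) 0).

Let remainderS y n : remainder y n.+1 = (size (D n))%:R * remainder y n - (digit y n)%:R.
Proof. by []. Qed.

Lemma remainder_itv y n : 0 <= y < 1 -> 0 <= remainder y n < 1.
Proof.
move=> y01; elim: n => // n /andP[h1 _]; rewrite remainderS /digit.
have h : 0 <= (size (D n))%:R * remainder y n by rewrite mulr_ge0.
by have /andP[] := truncn_itv h; rewrite -natr1; lra.
Qed.

Lemma digit_lt y n : 0 <= y < 1 -> (digit y n < size (D n))%N.
Proof.
move=> /(remainder_itv n) /andP[h1 h2]; rewrite -(ltr_nat R) /digit.
have h : 0 <= (size (D n))%:R * remainder y n by rewrite mulr_ge0.
have /andP[h3 _] := truncn_itv h; apply: le_lt_trans h3 _.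
by rewrite gtr_pMr// ltr0n.
Qed.

Lemma letter_mem y n : 0 <= y < 1 -> letter y n \in D n.
Proof. by move=> y01; rewrite mem_nth// digit_lt. Qed.

Lemma moran_prefix_lw y n : 0 <= y < 1 -> wlen (moran_prefix y n) = lsum n /\ wwt (moran_prefix y n) = wsum n.
Proof.
move=> y01; elim: n => [|n [IH1 IH2]].
  by rewrite wlen_nil wwt_nil /lsum /wsum !big_ord0.
by have [h1 h2] := D_lw (letter_mem n y01); rewrite wlen_cat wwt_cat IH1 IH2 h1 h2 lsumS wsumS.
Qed.

Lemma digits_eq_close y y' n : 0 <= y < 1 -> 0 <= y' < 1 ->
  (forall i, (i < n)%N -> digit y i = digit y' i) -> `|y - y'| <= (choices n)%:R^-1.
Proof.
move=> y01 y01' H.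
have e : y - y' = (remainder y n - remainder y' n) / (choices n)%:R.
  elim: n H => [|n IH] H; first by rewrite /choices big_ord0 divr1.
  rewrite IH; last by move=> i ni; apply: H; rewrite ltnW.
  rewrite choicesS !remainderS (H n (ltnSn n)) natrM; field.
  by rewrite !pnatr_eq0 -!lt0n size_gt0 choices_gt0.
rewrite e normrM normfV (ger0_norm (ler0n _ _)) ler_piMl ?invr_ge0//.
have := remainder_itv n y01; have := remainder_itv n y01'.
by rewrite ler_norml => /andP[? ?] /andP[? ?]; apply/andP; split; lra.
Qed.

Lemma cyl0_ge u : u != [::] -> 2^-1 ^+ wlen u <= cyl u 0 :> R.
Proof.
case: u => // n u _; rewrite /cyl addr0 /= exprVn ler_peMl ?invr_ge0 ?exprn_ge0//.
by rewrite ler1n addn_gt0 expn_gt0.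
Qed.

Lemma cyl_le u z z' : z <= z' -> cyl u z <= cyl u z'.
Proof. by move=> zz'; rewrite /cyl ler_pM2r ?invr_gt0 ?exprn_gt0// lerD2l. Qed.

Lemma cyl_ge0 u : 0 <= cyl u 0 :> R.
Proof. by rewrite /cyl addr0 divr_ge0 ?exprn_ge0. Qed.

Lemma cyl1_le1 u : cyl u 1 <= 1 :> R.
Proof.
have h : 0 < (1 : R) <= 1 by rewrite ltr01 lexx.
by have /andP[] := cyl_itv u h.
Qed.

(** A lower bound for every tail of a concatenation, whose next word ends in a one within the first
    lmax digits. *)
Let c0 := 2^-1 ^+ lmax : R.

(** The lower bound on z keeps the point off the excluded end 0 and provides the gap between
    cylinders in [moran_holder]. *)
Lemma moran_point_cyl y n : 0 <= y < 1 ->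
  exists z, [/\ c0 <= z, z <= 1 & moran_point y = cyl (moran_prefix y n) z].
Proof.
move=> y01; pose u n : R := cyl (moran_prefix y n) 0; pose v n : R := cyl (moran_prefix y n) 1.
have uS m : u m <= u m.+1 by rewrite /u /= cyl_cat cyl_le// cyl_ge0.
have vS m : v m.+1 <= v m by rewrite /v /= cyl_cat cyl_le// cyl1_le1.
have uv m : u m <= v m by rewrite cyl_le.
have umono : nondecreasing_seq u by exact/nondecreasing_seqP.
have vmono : nonincreasing_seq v by exact/nonincreasing_seqP.
have uvm m k : u m <= v k.
  have [mk|km] := leqP m k; first exact: le_trans (umono _ _ mk) (uv k).
  exact: le_trans (uv m) (vmono _ _ (ltnW km)).
have cu : cvgn u.
  by apply: nondecreasing_is_cvgn => //; exists (v 0%N) => _ [m _ <-].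
have lu m : u m <= moran_point y by exact: nondecreasing_cvgn_le.
have lv m : moran_point y <= v m by apply: limr_le => //; apply: nearW => k; exact: uvm.
have p0 : 0 < 2 ^+ wlen (moran_prefix y n) :> R by rewrite exprn_gt0.
exists (moran_point y * 2 ^+ wlen (moran_prefix y n) - (wcode (moran_prefix y n))%:R); split.
- apply: (@le_trans _ _ (cyl (letter y n) 0)).
    have ln0 := l_bound n; have [le _] := D_lw (letter_mem n y01).
    apply: le_trans (cyl0_ge _).
      rewrite le ler_wiXn2l ?invr_ge0// ?invf_le1 ?ler1n//.
      by case/andP: ln0.
    by apply/eqP => e; move: ln0; rewrite -le e wlen_nil.
  have := lu n.+1; rewrite /u /= cyl_cat {1}/cyl ler_pdivrMr//; lra.
- have := lv n; rewrite /v /cyl ler_pdivlMr//; lra.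
- by rewrite /cyl addrC subrK mulfK// gt_eqF.
Qed.

Lemma c0_gt0 : 0 < c0.
Proof. by rewrite exprn_gt0. Qed.

Lemma moran_point_itv y : 0 <= y < 1 -> 0 < moran_point y <= 1.
Proof.
move=> y01; have [z [z0 z1 ->]] := moran_point_cyl 0 y01.
by rewrite cyl_nil z1 (lt_le_trans c0_gt0).
Qed.

Lemma moran_birkhoff y n : 0 <= y < 1 -> birkhoff_sum (lsum n) (moran_point y) = (wsum n)%:R.
Proof.
move=> y01; have [z [z0 z1 ->]] := moran_point_cyl n y01.
have [<- <-] := moran_prefix_lw n y01.
by apply: (doubling_map_cyl _ _).2; rewrite z1 (lt_le_trans c0_gt0).
Qed.

Lemma lsum_ge n : (n <= lsum n)%N.
Proof.
elim: n => // n IH; rewrite lsumS; case/andP: (l_bound n) => h _.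
by rewrite -addn1 leq_add.
Qed.

Lemma lsum_bracket N : exists n, (lsum n <= N < lsum n.+1)%N.
Proof.
have ex : exists n, (N < lsum n.+1)%N by exists N; exact: lsum_ge.
exists (ex_minn ex); case: ex_minnP => -[|n] h hmin.
  by rewrite h andbT /lsum big_ord0.
by rewrite h andbT leqNgt; apply/negP => /hmin; rewrite ltnn.
Qed.

(** Birkhoff sums are known exactly at word ends; in between they are squeezed by monotonicity, and
    bounded word lengths leave a bounded error. *)
Lemma moran_point_level_set y : 0 <= y < 1 -> level_set a (moran_point y).
Proof.
move=> y01; split; first exact: moran_point_itv.
pose C' := C + `|a| * lmax%:R.
have C'0 : 0 <= C'.
  by rewrite addr_ge0 ?mulr_ge0// (le_trans _ (balanced 0)).
have key N : `|birkhoff_sum N (moran_point y) - a * N%:R| <= C'.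
  have [n /andP[h1 h2]] := lsum_bracket N.
  have b1 := @birkhoff_sum_mono R _ _ (moran_point y) h1.
  have b2 := @birkhoff_sum_mono R _ _ (moran_point y) (ltnW h2).
  rewrite !moran_birkhoff// in b1 b2.
  have := balanced n; have := balanced n.+1.
  move: b1 b2; move: (birkhoff_sum N _) => S b1 b2.
  rewrite !ler_norml => /andP[e1 e2] /andP[e3 e4].
  case/andP: (l_bound n) => _ ln.
  have a1 k : (k <= lmax)%N -> `|a * k%:R| <= `|a| * lmax%:R.
    by move=> kl; rewrite normrM normr_nat ler_wpM2l// ler_nat.
  have h3 : (N - lsum n <= lmax)%N 
    by rewrite leq_subLR (leq_trans (ltnW h2))// lsumS leq_add2l.
  have h4 : (lsum n.+1 - N <= lmax)%N 
    by rewrite leq_subLR lsumS leq_add.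
  have := a1 _ h3; have := a1 _ h4.
  rewrite !natrB// ?(ltnW h2)// !mulrBr !ler_norml => /andP[? ?] /andP[? ?].
  by rewrite /C'; apply/andP; split; lra.
apply/cvgrPdist_le => e e0.
pose N0 := (Num.truncn (C' / e)).+1.
have hN : C' / e < N0%:R.
  by have /andP[] := truncn_itv (divr_ge0 C'0 (ltW e0)).
exists N0 => // N /= N0N.
have Ngt : 0 < N%:R :> R by rewrite ltr0n (leq_trans _ N0N).
have -> : a - N%:R^-1 * birkhoff_sum N (moran_point y) =
   - (N%:R^-1 * (birkhoff_sum N (moran_point y) - a * N%:R)) by field; rewrite gt_eqF.
rewrite normrN normrM normfV normr_nat ler_pdivrMl// (le_trans (key N))//.
rewrite -ler_pdivrMr// ltW// (lt_le_trans hN)// ler_nat//.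
Qed.

(** At the first differing digit the two words have equal length and different codes, hence
    neighbouring or farther dyadic intervals. The gap c0 and the length of one word each cost at
    most 2^(-lmax), which explains the constant. *)
Lemma moran_holder y y' : 0 <= y < 1 -> 0 <= y' < 1 ->
  `|y - y'| <= K^-1 * 2 `^ (s * (2 * lmax%:R)) * `|moran_point y - moran_point y'| `^ s.
Proof.
move=> y01 y01'.
have [->|yy'] := eqVneq y y'.
  by rewrite subrr normr0 !mulr_ge0 ?powR_ge0// invr_ge0 ltW.
have d0 : 0 < `|y - y'| by rewrite normr_gt0 subr_eq0.
have choicesV n : (choices n)%:R^-1 <= K^-1 * 2 `^ (- (s * (lsum n)%:R)).
  rewrite powRN -invfM lef_pV2 ?posrE ?ltr0n ?choices_gt0 ?many// mulr_gt0// powR_gt0//.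
(* Otherwise the distance would be at most 1 / [choices n] for all n, which tends to 0 by [many]. *)
have ex : exists n, digit y n != digit y' n.
  apply: contrapT => no.
  have [u u0 hu] := exists_pow2_lt (mulr_gt0 K0 d0).
  pose n := (Num.truncn (u / s)).+1.
  have hn : u < s * n%:R.
    by rewrite mulrC -ltr_pdivrMr//; have /andP[] := truncn_itv (divr_ge0 u0 (ltW s0)).
  have same i : (i < n)%N -> digit y i = digit y' i.
    by move=> _; apply/eqP/negPn/negP => di; apply: no; exists i.
  have := le_trans (digits_eq_close y01 y01' same) (choicesV n).
  rewrite ler_pdivlMl//; apply/negP; rewrite -ltNge; apply: le_lt_trans hu.
  rewrite ler_powR ?ler1n// lerN2 (le_trans (ltW hn))// ler_pM2l// ler_nat.
  exact: lsum_ge.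
pose n := ex_minn ex.
have [dn hmin] : digit y n != digit y' n /\ forall i, (i < n)%N -> digit y i = digit y' i.
  rewrite /n; case: ex_minnP => m hm hmin; split=> // i im.
  by apply/eqP; apply/negPn/negP => /hmin; rewrite leqNgt im.
have pe : moran_prefix y n = moran_prefix y' n.
  move: hmin; elim: n {dn} => //= n IH h.
  rewrite IH; last by move=> i ni; apply: h; rewrite ltnW.
  by rewrite /letter (h n (ltnSn n)).
have [z [z0 z1 mE]] := moran_point_cyl n.+1 y01.
have [z' [z0' z1' mE']] := moran_point_cyl n.+1 y01'.
have [lu _] := D_lw (letter_mem n y01); have [lu' _] := D_lw (letter_mem n y01').
have codes : wcode (letter y n) != wcode (letter y' n).
  apply: contra dn => /eqP ce; have := wcode_inj (etrans lu (esym lu')) ce.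
  by move/eqP; rewrite nth_uniq ?digit_lt.
have dist : c0 * 2^-1 ^+ l n * 2^-1 ^+ lsum n <= `|moran_point y - moran_point y'|.
  rewrite mE mE' /= !cyl_cat pe cyl_affine normrM normfV normrX (ger0_norm (ler0n _ 2)).
  rewrite (moran_prefix_lw n y01').1 -exprVn ler_wpM2r ?exprn_ge0//.
  rewrite /cyl lu lu' -mulrBl normrM normfV normrX (ger0_norm (ler0n _ 2)) -exprVn ler_wpM2r ?exprn_ge0//.
  have : 1 <= `|(wcode (letter y n))%:R - (wcode (letter y' n))%:R| :> R.
    move: codes; rewrite neq_ltn => /orP[h|h].
      by rewrite distrC; apply: le_trans (ler_norm _); rewrite lerBrDr nat1r ler_nat.
    by apply: le_trans (ler_norm _); rewrite lerBrDr nat1r ler_nat.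
  move: (wcode (letter y n))%:R (wcode (letter y' n))%:R => p q pq.
  have : `|p - q| <= `|p + z - (q + z')| + `|z - z'|.
    by apply: le_trans (ler_normB _ _); apply: le_of_eq; congr (`|_|); ring.
  have : `|z - z'| <= 1 - c0 by rewrite ler_norml; apply/andP; split; lra.
  lra.
apply: le_trans (digits_eq_close y01 y01' hmin) _; apply: le_trans (choicesV n) _.
rewrite -mulrA ler_wpM2l ?invr_ge0 ?(ltW K0)//.
have -> : 2 `^ (- (s * (lsum n)%:R)) = (2 `^ (- (lsum n)%:R)) `^ s :> R.
  by rewrite -powRrM mulNr mulrC.
have -> : 2 `^ (s * (2 * lmax%:R)) = (2 `^ (2 * lmax%:R)) `^ s :> R.
  by rewrite -powRrM mulrC.
rewrite -powRM ?powR_ge0//.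
apply: ge0_ler_powR; rewrite ?nnegrE ?mulr_ge0 ?powR_ge0 ?(ltW s0)//.
rewrite -ler_pdivrMl ?powR_gt0//; apply: le_trans dist.
have -> : 2 `^ (- (lsum n)%:R) = 2^-1 ^+ lsum n :> R by rewrite powRN powR_mulrn// exprVn.
have -> : (2 `^ (2 * lmax%:R))^-1 = c0 * c0.
  by rewrite -natrM powR_mulrn// -exprVn mul2n -addnn exprD.
rewrite ler_wpM2r ?exprn_ge0// ler_wpM2l ?exprn_ge0//.
by rewrite ler_wiXn2l ?invr_ge0// ?invf_le1 ?ler1n//; case/andP: (l_bound n).
Qed.

Lemma moran_dim : (s%:E <= hausdorff_dim (level_set a))%E.
Proof.
apply: (hausdorff_dim_holder _ moran_point_level_set _ moran_holder).
  by rewrite mulr_ge0 ?powR_ge0// invr_ge0 ltW.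
move=> y y' /moran_point_itv/andP[h1 h2] /moran_point_itv/andP[h3 h4].
by rewrite ler_norml; apply/andP; split; lra.
Qed.

End Moran.

(** * Greedy construction and the dimension formula *)

Section LowerBound.
Context {R : realType}.
Implicit Types (a c s : R).

Lemma heavy_letter (b : R) : 0 <= b -> exists j, b * len j <= wt j.
Proof.
move=> b0; exists (Num.truncn (2 * b)).+1; set j := _.+1.
have hj : 2 * b <= j%:R.
  by have /andP[_ /ltW] := truncn_itv (mulr_ge0 (ler0n R 2) b0).
have := @leq_exp2 j.+1; rewrite /= -(ler_nat R) !natrM natrB ?expn_gt0// natrX.
rewrite -/(@wt R j) -/(@len R j) => h.
have : 2 * b * len j <= j%:R * len j by rewrite ler_wpM2r// ltW// len_gt0.
by move: h; rewrite [len j * _]mulrC -mulrA; lra.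
Qed.

(* Words of D push (weight - a * length) down and have many choices; when it
   becomes negative, a single heavy block pushes it up at a small cost in
   length. The quantity log2 choices - s * length + e * (weight - a * length)
   never decreases. *)
Lemma hausdorff_dim_greedy a s c (D : seq (seq nat)) (l w : nat) :
  1 < a -> 0 < s < c -> uniq D -> (0 < l)%N ->
  {in D, forall u, wlen u = l /\ wwt u = w} ->
  w%:R <= a * l%:R -> 2 `^ (c * l%:R) <= (size D)%:R ->
  (s%:E <= hausdorff_dim (level_set a))%E.
Proof.
move=> a1 /andP[s0 sc] uD l0 hD wal sD.
have am : 0 < a - 1 by rewrite subr_gt0.
(* A word of D lowers weight - a length by m <= (a - 1) l, because w >= l; hence e m <= (c - s) l,
   the surplus of its choices over s l. *)
pose e := (c - s) / (a - 1); have e0 : 0 < e by rewrite divr_gt0 ?subr_gt0.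
have se0 : 0 <= s / e by rewrite ltW// divr_gt0.
(* For this letter e k >= s length: the gain in balance pays for a length that brings no choices. *)
have [j hj] := @heavy_letter (a + s / e) (addr_ge0 (ltW (lt_trans ltr01 a1)) se0).
pose k := wt j - a * len j; have hk : s / e * len j <= k by rewrite /k; lra.
have k0 : 0 <= k by apply: le_trans hk; rewrite mulr_ge0// ltW// len_gt0.
have D_gt0 : (0 < size D)%N by rewrite -(ltr_nat R) (lt_le_trans _ sD)// powR_gt0.
have lw : l%:R <= w%:R :> R.
  case: D hD D_gt0 {uD sD} => // u D /(_ u (mem_head _ _)) [<- <-] _.
  by rewrite ler_nat wlen_le_wwt.
pose m := a * l%:R - w%:R; have m0 : 0 <= m by rewrite subr_ge0.
pose E n := iter n (fun x => x + (if 0 <= x then - m else k)) 0 : R.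
have ES n : E n.+1 = E n + (if 0 <= E n then - m else k) by [].
have E_bound n : - m <= E n <= k.
  elim: n => [|n /andP[IH1 IH2]]; first by rewrite /E /= oppr_le0 m0 k0.
  by rewrite ES; case: ifPn => [h|]; rewrite -?ltNge => *; apply/andP; split; lra.
pose D' n := if 0 <= E n then D else [:: [:: j]].
pose l' n := if 0 <= E n then l else j.+1.
pose w' n := if 0 <= E n then w else (2 ^ j.+1 - 1)%N.
have lS n : lsum l' n.+1 = (lsum l' n + l' n)%N by rewrite /lsum big_ord_recr.
have wS n : wsum w' n.+1 = (wsum w' n + w' n)%N by rewrite /wsum big_ord_recr.
have cS n : choices D' n.+1 = (choices D' n * size (D' n))%N by rewrite /choices big_ord_recr.
have EE n : (wsum w' n)%:R - a * (lsum l' n)%:R = E n.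
  elim: n => [|n IH]; first by rewrite /wsum /lsum !big_ord0 mulr0 subrr.
  rewrite ES -IH lS wS !natrD IH /l' /w'; case: ifP => _; first by rewrite /m -IH; ring.
  by rewrite natrB ?expn_gt0// natrX -IH /k /wt /len; ring.
have em : e * m <= (c - s) * l%:R.
  rewrite /e -mulrA ler_wpM2l ?subr_ge0 ?(ltW sc)// mulrC ler_pdivrMr// /m; lra.
have ek : s * len j <= e * k.
  by have := ler_wpM2l (ltW e0) hk; rewrite mulrA (mulrC e) divfK ?gt_eqF.
have pot n : 2 `^ (s * (lsum l' n)%:R - e * E n) <= (choices D' n)%:R.
  elim: n => [|n IH].
    by rewrite /lsum /choices !big_ord0 /E /= !mulr0 subrr powRr0.
  rewrite cS lS natrD natrM ES /l' /D'; case: ifP => _.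
    apply: (@le_trans _ _ (2 `^ (s * (lsum l' n)%:R - e * E n) * 2 `^ (c * l%:R))); last first.
      by rewrite ler_pM ?powR_ge0.
    rewrite -powRD ?pnatr_eq0 ?implybT// ler_powR ?ler1n//.
    by move: em; move: (E n) (_%:R) (_%:R) => x y z; lra.
  rewrite mulr1; apply: le_trans IH; rewrite ler_powR ?ler1n//.
  by move: ek; rewrite /len; move: (E n) (_%:R) (_%:R) => x y z; lra.
apply: (@moran_dim R a s (2 `^ (- (e * (m + k)))) (m + k) (maxn l j.+1) D' l' w') => //.
- by move=> i; rewrite /D'; case: ifP.
- move=> i; rewrite /D' /l' /w'; case: ifP => // _ u; rewrite inE => /eqP ->.
  by rewrite /wlen /wwt !big_seq1.
- by move=> i; rewrite /l'; case: ifP => _; rewrite ?l0 ?leq_maxl ?leq_maxr.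
- move=> n; rewrite EE ler_norml; have /andP[h1 h2] := E_bound n.
  by apply/andP; split; lra.
- move=> n; apply: le_trans (pot n); rewrite -powRD ?pnatr_eq0 ?implybT// ler_powR ?ler1n//.
  have : e * E n <= e * (m + k).
    by rewrite ler_wpM2l ?(ltW e0)//; have /andP[h1 h2] := E_bound n; lra.
  by move: (e * E n) (e * (m + k)) (s * _) => x y z; lra.
Qed.

Lemma hausdorff_dim_ge0 (A : set R) : (0 <= hausdorff_dim A)%E.
Proof. by apply: le_ereal_inf_tmp => _ [u [u0 _] <-]; rewrite lee_fin. Qed.

Lemma hausdorff_dim_level_set a : 1 <= a -> hausdorff_dim (level_set a) = (legendre a)%:E.
Proof.
move=> a1; apply/eqP; rewrite eq_le; apply/andP; split.
  rewrite -ereal_inf_legendre//; apply: le_ereal_inf_tmp => _ [q q0 <-].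
  exact: hausdorff_dim_level_set_le.
move: a1; rewrite [1 <= a]le_eqVlt => /orP[/eqP <-|{}a1]; first by rewrite legendre1 hausdorff_dim_ge0.
apply/lee_addgt0Pr => e e0; rewrite -leeBlDr// -EFinB.
have [le0|lpos] := leP (legendre a - e) 0.
  by apply: le_trans (hausdorff_dim_ge0 _); rewrite lee_fin.
have [|D [l [w [uD l0 hD wal sD]]]] := @many_words R a (legendre a - e / 2) a1.
  by rewrite gtrBl divr_gt0.
apply: (hausdorff_dim_greedy a1 _ uD l0 hD wal sD).
by rewrite lpos/= ltrD2l ltrN2 gtr_pMr// invf_lt1// ltr1n.
Qed.

End LowerBound.

Theorem theorem1p1 (R : realType) :
  let dimE (alpha : R) : \bar R := hausdorff_dim (level_set alpha) in
  (forall alpha : R, 1 <= alpha ->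
     dimE alpha =
       ereal_inf [set (pressure_root q + q * alpha)%:E | q in [set q : R | 0 < q]])
  /\ dimE 1 = 0%E
  /\ (forall alpha beta : R, 1 <= alpha -> alpha < beta ->
        (dimE alpha < dimE beta)%E)
  /\ concave_on [set alpha : R | 1 <= alpha] (fun alpha => fine (dimE alpha))
  /\ real_analytic_on [set alpha : R | 1 < alpha] (fun alpha => fine (dimE alpha))
  /\ (dimE alpha @[alpha --> +oo] --> 1%E).
Proof.
move=> dimE; have dimEE a : 1 <= a -> dimE a = (legendre a)%:E := @hausdorff_dim_level_set R a.
split; first by move=> a a1; rewrite dimEE// ereal_inf_legendre.
split; first by rewrite dimEE// legendre1.
split.
  move=> a b a1 ab; rewrite !dimEE ?lte_fin ?legendre_lt//.
  exact: le_trans a1 (ltW ab).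
split.
  move=> a b t /= a1 b1 t01; have ab1 : 1 <= t * a + (1 - t) * b.
    have /andP[t0 t1] := t01; have := ler_wpM2l t0 a1.
    have t1' : 0 <= 1 - t by rewrite subr_ge0.
    by have := ler_wpM2l t1' b1; lra.
  by rewrite !dimEE//=; exact: legendre_concave.
split.
  move=> a /= a1; have [c [r [r0 hc]]] := legendre_analytic a1.
  (* The disc is kept inside [1, +oo[, where [dimEE] applies. *)
  exists c, (Num.min r (a - 1)); split; first by rewrite lt_min r0 subr_gt0.
  move=> x; rewrite lt_min => /andP[xr xa].
  rewrite dimEE/=; first exact: hc.
  by move: xa; rewrite ltr_norml => /andP[]; lra.
have h : legendre a @[a --> +oo] --> (1 : R).
  apply/cvgrPdist_lt => e e0; have [A hA] := @legendre_near1 R (1 - e) (ltac:(by rewrite gtrBl)).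
  exists (Num.max 1 A); split; first exact: num_real.
  move=> a; rewrite gt_max => /andP[a1 Aa].
  have := hA a (ltW Aa); have := legendre_le1 (ltW a1).
  by move=> h1 h2; rewrite ger0_norm ?subr_ge0//; lra.
have near1 : \forall a \near +oo, dimE a = (legendre a)%:E.
  exists 1; split; first exact: num_real.
  by move=> a a1; rewrite dimEE// ltW.
apply/fine_cvgP; split; first by apply: filterS near1 => a ->.
by apply: cvg_trans h; apply: near_eq_cvg; apply: filterS near1 => a /= ->.
Qed.
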